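(* For each $d\in[1,\omega]$ (so $d$ is a positive integer or $d=\omega$), every projective Boolean algebra has the $d$-ary SFN, and every Boolean algebra with the $d$-ary SFN has the $d$-ary FN.
   Context: A Boolean algebra is projective if it is a projective object in the category of Boolean algebras and homomorphisms (equivalently, a retract of a free Boolean algebra). Commuting subalgebras: given subalgebras $A_0,\dots,A_{n-1}$ of a Boolean algebra $B$, let $P$ be the quotient of the free product (coproduct) $\bigoplus_{i<n}A_i$, with cofactor embeddings $\iota_i\colon A_i\to\bigoplus_{i<n}A_i$, by the ideal generated by all elements $\iota_i(z)\wedge\iota_j(-z)$ with $i,j<n$ and $z\in A_i\cap A_j$. There is a unique homomorphism $P\to B$ sending the class of $\iota_i(a)$ to $a$ for all $i$ and $a\in A_i$; the tuple $(A_i)_{i<n}$ commutes in $B$ if this homomorphism is injective. For $d\le\omega$, a Boolean algebra $A$ has the $d$-ary SFN if it has a family $\mathcal{E}$ of finite subalgebras, cofinal in the set of finite subalgebras of $A$ under inclusion, such that every tuple $B_0,\dots,B_{n-1}\in\mathcal{E}$ with $n<1+d$ commutes in $A$. For $B\le A$, $B\le_{\mathrm{rc}}A$ means every $y\in A$ has a largest element of $B$ below it. A club in $[A]^{<\aleph_1}$ is a family of countable subsets cofinal under inclusion and closed under unions of countable nonempty chains. $A$ has the $d$-ary FN if there is a club $\mathcal{E}\subseteq[A]^{<\aleph_1}$ with $B\le_{\mathrm{rc}}A$ for every subalgebra $B$ generated by a union of fewer than $d$ elements of $\mathcal{E}$. *)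

(* Defs.v *)
From HB Require Import structures.
From mathcomp Require Import all_boot all_order.
From mathcomp Require Import boolp classical_sets cardinality.

Set Implicit Arguments.
Unset Strict Implicit.
Unset Printing Implicit Defensive.

Import Order.Theory.

Local Open Scope quotient_scope.

Local Open Scope classical_set_scope.
Local Open Scope order_scope.

(** Boolean algebras are the [ctbDistrLatticeType]s; [\bot = \top] is allowed.
    All of MathComp's order structures require a [choiceType]; with the axioms
    of [boolp] this is no restriction on the underlying type. *)

(** The library's [{tblmorphism _ -> _}] only preserves [\bot] and [\top], so
    it has to be joined with [{lmorphism _ -> _}].  Preservation of complements
    follows ([bahomC]). *)
HB.structure Definition BAHom d (A : ctbDistrLatticeType d)
    d' (B : ctbDistrLatticeType d') :=
  {f of @Order.LatticeMorphism d A d' B f & @Order.TBLatticeMorphism d A d' B f}.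

Notation "{ 'bahom' A -> B }" := (@BAHom.type _ A%type _ B%type)
  (at level 0, A at level 98, B at level 99,
   format "{ 'bahom'  A  ->  B }") : type_scope.

HB.factory Record isBAHom d (A : ctbDistrLatticeType d)
    d' (B : ctbDistrLatticeType d') (f : A -> B) := {
  bahomI_subproof : {morph f : x y / x `&` y};
  bahomU_subproof : {morph f : x y / x `|` y};
  bahom0_subproof : f \bot = \bot;
  bahom1_subproof : f \top = \top
}.

HB.builders Context d A d' B f of isBAHom d A d' B f.

Fact f_homo : {homo f : x y / x <= y}.
Proof. by move=> x y; rewrite !leEmeet => /eqP xy; rewrite -bahomI_subproof xy. Qed.

HB.instance Definition _ := Order.isOrderMorphism.Build d A d' B f f_homo.
HB.instance Definition _ := Order.isLatticeMorphism.Build d A d' B f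
  bahomI_subproof bahomU_subproof.
HB.instance Definition _ := Order.isBLatticeMorphism.Build d A d' B f
  bahom0_subproof.
HB.instance Definition _ := Order.isTLatticeMorphism.Build d A d' B f
  bahom1_subproof.

HB.end.

Lemma compl_uniq d (A : ctbDistrLatticeType d) (x y : A) :
  x `&` y = \bot -> x `|` y = \top -> y = ~` x.
Proof.
move=> xy0 xy1.
have -> : y = y `&` ~` x.
  by rewrite -[LHS]meetx1 -(joinxC x) meetUr [y `&` x]meetC xy0 join0x.
rewrite -[RHS]meetx1 -xy1 meetUr [~` x `&` x]meetC meetxC join0x.
exact: meetC.
Qed.

Lemma bahomC d (A : ctbDistrLatticeType d) d' (B : ctbDistrLatticeType d')
  (f : {bahom A -> B}) : {morph f : x / ~` x}.
Proof.
move=> x; apply: compl_uniq.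
  by rewrite -omorphI meetxC /= omorph0.
by rewrite -omorphU joinxC /= omorph1.
Qed.

Section BAHomComp.
Variables (d : Order.disp_t) (A : ctbDistrLatticeType d).
Variables (d' : Order.disp_t) (B : ctbDistrLatticeType d').
Variables (d'' : Order.disp_t) (C : ctbDistrLatticeType d'').
Variables (g : {bahom B -> C}) (f : {bahom A -> B}).

HB.instance Definition _ := Order.OrderMorphism.on (@idfun A).
HB.instance Definition _ := Order.OrderMorphism.on (g \o f).

End BAHomComp.

(** ** Projective Boolean algebras *)

Definition epimorphism d (A : ctbDistrLatticeType d)
    d' (B : ctbDistrLatticeType d') (p : {bahom A -> B}) : Prop :=
  forall d'' (C : ctbDistrLatticeType d'') (g h : {bahom B -> C}),
    g \o p =1 h \o p -> g =1 h.

Definition projective d (A : ctbDistrLatticeType d) : Prop :=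
  forall d1 (C : ctbDistrLatticeType d1) d2 (D : ctbDistrLatticeType d2)
    (p : {bahom C -> D}) (f : {bahom A -> D}),
    epimorphism p -> exists g : {bahom A -> C}, p \o g =1 f.

(** ** Subalgebras *)

Definition is_subalgebra d (A : ctbDistrLatticeType d) (S : set A) : Prop :=
  [/\ S \bot, S \top, (forall x, S x -> S (~` x)),
      (forall x y, S x -> S y -> S (x `&` y)) &
      (forall x y, S x -> S y -> S (x `|` y))].

Record subalgebra d (A : ctbDistrLatticeType d) := Subalgebra {
  subalg_set :> set A;
  subalgP : is_subalgebra subalg_set
}.

Section SubalgebraType.
Variables (d : Order.disp_t) (A : ctbDistrLatticeType d) (S : subalgebra A).

Definition subalg_pred : pred A := fun x => `[< subalg_set S x >].

Record subalg_type := SubalgElt {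
  subalg_val :> A;
  _ : subalg_pred subalg_val
}.

HB.instance Definition _ := [isSub for subalg_val].
HB.instance Definition _ := [Choice of subalg_type by <:].

Lemma subalg_val_inj : injective subalg_val.
Proof. exact: val_inj. Qed.

Fact subalg_opredI : {in subalg_pred &, forall x y, x `&` y \in subalg_pred}.
Proof.
move=> x y /asboolP Sx /asboolP Sy.
by apply/asboolP; case: (subalgP S) => _ _ _ SI _; apply: SI.
Qed.

Fact subalg_opredU : {in subalg_pred &, forall x y, x `|` y \in subalg_pred}.
Proof.
move=> x y /asboolP Sx /asboolP Sy.
by apply/asboolP; case: (subalgP S) => _ _ _ _ SU; apply: SU.
Qed.

Fact subalg_opred0 : \bot \in subalg_pred.
Proof. by apply/asboolP; case: (subalgP S). Qed.

Fact subalg_opred1 : \top \in subalg_pred.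
Proof. by apply/asboolP; case: (subalgP S). Qed.

HB.instance Definition _ := Order.SubChoice_isTBSubLattice.Build d A
  subalg_pred d subalg_type
  subalg_opredI subalg_opredU subalg_opred0 subalg_opred1.

Fact subalg_valI : {morph subalg_val : x y / x `&` y}.
Proof. by []. Qed.

Fact subalg_valU : {morph subalg_val : x y / x `|` y}.
Proof. by []. Qed.

Fact subalg_val0 : subalg_val \bot = \bot.
Proof. by []. Qed.

Fact subalg_val1 : subalg_val \top = \top.
Proof. by []. Qed.

Fact subalg_meetUl :
  @left_distributive subalg_type subalg_type Order.meet Order.join.
Proof.
by move=> x y z; apply: subalg_val_inj; rewrite !(subalg_valI, subalg_valU) meetUl.
Qed.

HB.instance Definition _ := Order.Lattice_Meet_isDistrLattice.Build d subalg_type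
  subalg_meetUl.

Fact subalg_complP (x : subalg_type) : subalg_pred (~` subalg_val x).
Proof.
apply/asboolP; case: (subalgP S) => _ _ SC _ _; apply: SC.
by case: x => x /= /asboolP.
Qed.

Definition subalg_compl (x : subalg_type) := SubalgElt (subalg_complP x).

Fact subalg_joinxC x : x `|` subalg_compl x = \top.
Proof. by apply: subalg_val_inj; rewrite subalg_valU joinxC subalg_val1. Qed.

Fact subalg_meetxC x : x `&` subalg_compl x = \bot.
Proof. by apply: subalg_val_inj; rewrite subalg_valI meetxC subalg_val0. Qed.

HB.instance Definition _ := Order.TBDistrLattice_hasComplement.Build d
  subalg_type subalg_joinxC subalg_meetxC.

HB.instance Definition _ := isBAHom.Build d subalg_type d A subalg_val
  subalg_valI subalg_valU subalg_val0 subalg_val1.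

End SubalgebraType.

Section GeneratedSubalgebra.
Variables (d : Order.disp_t) (A : ctbDistrLatticeType d) (X : set A).

Fact gen_subalgP : is_subalgebra (smallest (@is_subalgebra d A) X).
Proof.
split=> [S [[]]|S [[]]|x Sx S SX|x y Sx Sy S SX|x y Sx Sy S SX] //;
  have := Sx _ SX; case: (SX) => -[_ _ SC SI SU] _; first exact: SC.
- by move=> /SI; apply; apply: Sy.
- by move=> /SU; apply; apply: Sy.
Qed.

Definition gen_subalg : subalgebra A := Subalgebra gen_subalgP.

End GeneratedSubalgebra.

(** ** Quotients

    [ba_congr] packages a type with Boolean operations that satisfy the axioms
    of Boolean algebras up to a congruence; [ba_quot] is the resulting algebra. *)

Record ba_congr := BACongr {
  bc_sort : Type;
  bc_eq : bc_sort -> bc_sort -> Prop;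
  bc_bot : bc_sort;
  bc_top : bc_sort;
  bc_compl : bc_sort -> bc_sort;
  bc_meet : bc_sort -> bc_sort -> bc_sort;
  bc_join : bc_sort -> bc_sort -> bc_sort;
  bc_refl : forall x, bc_eq x x;
  bc_sym : forall x y, bc_eq x y -> bc_eq y x;
  bc_trans : forall x y z, bc_eq x y -> bc_eq y z -> bc_eq x z;
  bc_complW : forall x x', bc_eq x x' -> bc_eq (bc_compl x) (bc_compl x');
  bc_meetW : forall x x' y y', bc_eq x x' -> bc_eq y y' ->
    bc_eq (bc_meet x y) (bc_meet x' y');
  bc_joinW : forall x x' y y', bc_eq x x' -> bc_eq y y' ->
    bc_eq (bc_join x y) (bc_join x' y');
  bc_meetC : forall x y, bc_eq (bc_meet x y) (bc_meet y x);
  bc_joinC : forall x y, bc_eq (bc_join x y) (bc_join y x);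
  bc_meetA : forall x y z,
    bc_eq (bc_meet x (bc_meet y z)) (bc_meet (bc_meet x y) z);
  bc_joinA : forall x y z,
    bc_eq (bc_join x (bc_join y z)) (bc_join (bc_join x y) z);
  bc_joinKI : forall y x, bc_eq (bc_meet x (bc_join x y)) x;
  bc_meetKU : forall y x, bc_eq (bc_join x (bc_meet x y)) x;
  bc_meetUl : forall x y z,
    bc_eq (bc_meet (bc_join x y) z) (bc_join (bc_meet x z) (bc_meet y z));
  bc_meetxC : forall x, bc_eq (bc_meet x (bc_compl x)) bc_bot;
  bc_joinxC : forall x, bc_eq (bc_join x (bc_compl x)) bc_top
}.

Section BAQuotType.
Variable S : ba_congr.

Definition bc_rel : rel {classic bc_sort S} := fun x y => `[< bc_eq x y >].

Fact bc_equiv : equiv_class_of bc_rel.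
Proof.
split=> [x|x y|y x z].
- exact/asboolP/bc_refl.
- by apply/asboolP/asboolP => /bc_sym.
- by move=> /asboolP xy /asboolP yz; apply/asboolP/(bc_trans xy yz).
Qed.

Canonical bc_equiv_rel := EquivRelPack bc_equiv.

End BAQuotType.

(** The display [d] is a phantom argument, for the order structure below. *)
Definition ba_quot (d : Order.disp_t) (S : ba_congr) : Type :=
  {eq_quot (bc_equiv_rel S)}.

Section BAQuot.
Variables (d : Order.disp_t) (S : ba_congr).

Local Notation ba_quot := (ba_quot d S).

HB.instance Definition _ := Choice.on ba_quot.

Definition ba_pi (x : bc_sort S) : ba_quot :=
  \pi_({eq_quot (bc_equiv_rel S)}) (x : {classic bc_sort S}).

Lemma ba_piP x y : ba_pi x = ba_pi y <-> bc_eq x y.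
Proof.
split=> [/eqquotP /asboolP //|xy].
by apply/eqquotP/asboolP.
Qed.

Lemma ba_quotW (P : ba_quot -> Prop) : (forall x, P (ba_pi x)) -> forall x, P x.
Proof. by move=> PP; elim/quotW => x; apply: PP. Qed.

Definition ba_repr (x : ba_quot) : bc_sort S :=
  repr (x : {eq_quot (bc_equiv_rel S)}).

Lemma ba_reprK x : ba_pi (ba_repr x) = x.
Proof. exact: (@reprK _ {eq_quot (bc_equiv_rel S)}). Qed.

Lemma ba_repr_pi x : bc_eq (ba_repr (ba_pi x)) x.
Proof. by apply/ba_piP; rewrite ba_reprK. Qed.

Let meet x y := ba_pi (bc_meet (ba_repr x) (ba_repr y)).
Let join x y := ba_pi (bc_join (ba_repr x) (ba_repr y)).
Let compl x := ba_pi (bc_compl (ba_repr x)).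

Fact pi_meet x y : meet (ba_pi x) (ba_pi y) = ba_pi (bc_meet x y).
Proof. by apply/ba_piP/bc_meetW; apply: ba_repr_pi. Qed.

Fact pi_join x y : join (ba_pi x) (ba_pi y) = ba_pi (bc_join x y).
Proof. by apply/ba_piP/bc_joinW; apply: ba_repr_pi. Qed.

Fact pi_compl x : compl (ba_pi x) = ba_pi (bc_compl x).
Proof. by apply/ba_piP/bc_complW/ba_repr_pi. Qed.

Let piE := (pi_meet, pi_join, pi_compl).

Fact quot_meetC : commutative meet.
Proof.
by elim/ba_quotW => x; elim/ba_quotW => y; rewrite !piE; apply/ba_piP/bc_meetC.
Qed.

Fact quot_joinC : commutative join.
Proof.
by elim/ba_quotW => x; elim/ba_quotW => y; rewrite !piE; apply/ba_piP/bc_joinC.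
Qed.

Fact quot_meetA : associative meet.
Proof.
elim/ba_quotW => x; elim/ba_quotW => y; elim/ba_quotW => z.
by rewrite !piE; apply/ba_piP/bc_meetA.
Qed.

Fact quot_joinA : associative join.
Proof.
elim/ba_quotW => x; elim/ba_quotW => y; elim/ba_quotW => z.
by rewrite !piE; apply/ba_piP/bc_joinA.
Qed.

Fact quot_joinKI y x : meet x (join x y) = x.
Proof.
elim/ba_quotW: x => x; elim/ba_quotW: y => y.
by rewrite !piE; apply/ba_piP/bc_joinKI.
Qed.

Fact quot_meetKU y x : join x (meet x y) = x.
Proof.
elim/ba_quotW: x => x; elim/ba_quotW: y => y.
by rewrite !piE; apply/ba_piP/bc_meetKU.
Qed.

Fact quot_meetUl : left_distributive meet join.
Proof.
elim/ba_quotW => x; elim/ba_quotW => y; elim/ba_quotW => z.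
by rewrite !piE; apply/ba_piP/bc_meetUl.
Qed.

Fact quot_meetxx : idempotent_op meet.
Proof. by move=> x; rewrite -{2}[x](quot_meetKU x) quot_joinKI. Qed.

Let le x y := meet x y == x.
Let lt x y := (y != x) && le x y.

HB.instance Definition _ := Order.isMeetJoinDistrLattice.Build d ba_quot
  (fun x y => erefl (le x y)) (fun x y => erefl (lt x y))
  quot_meetC quot_joinC quot_meetA quot_joinA quot_joinKI quot_meetKU
  quot_meetUl quot_meetxx.

Fact quot_meetxC x : meet x (compl x) = ba_pi (bc_bot S).
Proof. by elim/ba_quotW: x => x; rewrite !piE; apply/ba_piP/bc_meetxC. Qed.

Fact quot_joinxC x : join x (compl x) = ba_pi (bc_top S).
Proof. by elim/ba_quotW: x => x; rewrite !piE; apply/ba_piP/bc_joinxC. Qed.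

Fact quot_le0x (x : ba_quot) : ba_pi (bc_bot S) <= x.
Proof. by rewrite -(quot_meetxC x); apply: leIl. Qed.

Fact quot_lex1 (x : ba_quot) : x <= ba_pi (bc_top S).
Proof. by rewrite -(quot_joinxC x); apply: leUl. Qed.

HB.instance Definition _ := Order.hasBottom.Build d ba_quot quot_le0x.
HB.instance Definition _ := Order.hasTop.Build d ba_quot quot_lex1.
HB.instance Definition _ := Order.TBDistrLattice_hasComplement.Build d ba_quot
  quot_joinxC quot_meetxC.

Lemma ba_piI x y : ba_pi (bc_meet x y) = ba_pi x `&` ba_pi y.
Proof. by rewrite -pi_meet. Qed.

Lemma ba_piU x y : ba_pi (bc_join x y) = ba_pi x `|` ba_pi y.
Proof. by rewrite -pi_join. Qed.

Lemma ba_piC x : ba_pi (bc_compl x) = ~` ba_pi x.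
Proof. by apply: compl_uniq; rewrite -?ba_piI -?ba_piU; apply/ba_piP;
  [apply: bc_meetxC | apply: bc_joinxC]. Qed.

End BAQuot.

(** ** Ideals and quotients by ideals *)

Definition is_ideal d (A : ctbDistrLatticeType d) (I : set A) : Prop :=
  [/\ I \bot, (forall x y, x <= y -> I y -> I x) &
      (forall x y, I x -> I y -> I (x `|` y))].

Record ideal d (A : ctbDistrLatticeType d) := Ideal {
  ideal_set :> set A;
  idealP : is_ideal ideal_set
}.

Section GeneratedIdeal.
Variables (d : Order.disp_t) (A : ctbDistrLatticeType d) (X : set A).

Fact gen_idealP : is_ideal (smallest (@is_ideal d A) X).
Proof.
split=> [I [[]]|x y xy Iy I IX|x y Ix Iy I IX] //; case: (IX) => -[_ Ile IU] _.
- by apply: Ile xy _; apply: Iy.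
- by apply: IU; [apply: Ix | apply: Iy].
Qed.

Definition gen_ideal : ideal A := Ideal gen_idealP.

End GeneratedIdeal.

Section Quotient.
Variables (d : Order.disp_t) (A : ctbDistrLatticeType d) (I : ideal A).
Implicit Types x y : A.

Let Ile x y : x <= y -> ideal_set I y -> ideal_set I x.
Proof. by case: (idealP I) => _ + _; apply. Qed.

Let IU x y : ideal_set I x -> ideal_set I y -> ideal_set I (x `|` y).
Proof. by case: (idealP I) => _ _; apply. Qed.

Definition ideal_eq x y : Prop :=
  ideal_set I (x `&` ~` y) /\ ideal_set I (y `&` ~` x).

Fact ideal_eq_refl x : ideal_eq x x.
Proof. by split; rewrite meetxC; case: (idealP I). Qed.

Fact ideal_eq_sym x y : ideal_eq x y -> ideal_eq y x.
Proof. by case. Qed.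

Let le_trans3 x y z : x `&` ~` z <= (x `&` ~` y) `|` (y `&` ~` z).
Proof.
rewrite -[leLHS]meetx1 -(joinxC y) meetUr leUx; apply/andP; split.
  by apply: lexU2; apply/orP; right; rewrite lexI leIr (le_trans (leIl _ _) (leIr _ _)).
by apply: lexU2; rewrite leI2 ?leIl.
Qed.

Fact ideal_eq_trans x y z : ideal_eq x y -> ideal_eq y z -> ideal_eq x z.
Proof.
move=> [xy yx] [yz zy]; split; apply: (Ile (le_trans3 _ y _)); exact: IU.
Qed.

Fact ideal_eqC x x' : ideal_eq x x' -> ideal_eq (~` x) (~` x').
Proof. by move=> [xx' x'x]; split; rewrite complK meetC. Qed.

Fact ideal_eqI x x' y y' :
  ideal_eq x x' -> ideal_eq y y' -> ideal_eq (x `&` y) (x' `&` y').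
Proof.
have le4 (a a' b b' : A) :
    (a `&` b) `&` ~` (a' `&` b') <= (a `&` ~` a') `|` (b `&` ~` b').
  by rewrite complI meetUr leU2 // leI2 ?leIl ?leIr.
by move=> [? ?] [? ?]; split; apply: (Ile (le4 _ _ _ _)); apply: IU.
Qed.

Fact ideal_eqU x x' y y' :
  ideal_eq x x' -> ideal_eq y y' -> ideal_eq (x `|` y) (x' `|` y').
Proof.
move=> xx' yy'; rewrite -(complK (x `|` y)) -(complK (x' `|` y')) !complU.
by apply/ideal_eqC/ideal_eqI; apply: ideal_eqC.
Qed.

Let ideal_eqW x y : x = y -> ideal_eq x y.
Proof. by move=> ->; apply: ideal_eq_refl. Qed.

Definition ideal_congr : ba_congr := {|
  bc_refl := ideal_eq_refl;
  bc_sym := ideal_eq_sym;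
  bc_trans := ideal_eq_trans;
  bc_complW := ideal_eqC;
  bc_meetW := ideal_eqI;
  bc_joinW := ideal_eqU;
  bc_meetC := fun x y => ideal_eqW (meetC x y);
  bc_joinC := fun x y => ideal_eqW (joinC x y);
  bc_meetA := fun x y z => ideal_eqW (meetA x y z);
  bc_joinA := fun x y z => ideal_eqW (joinA x y z);
  bc_joinKI := fun y x => ideal_eqW (joinKI y x);
  bc_meetKU := fun y x => ideal_eqW (meetKU y x);
  bc_meetUl := fun x y z => ideal_eqW (meetUl x y z);
  bc_meetxC := fun x => ideal_eqW (meetxC x);
  bc_joinxC := fun x => ideal_eqW (joinxC x)
|}.

Definition quotient : ctbDistrLatticeType d := ba_quot d ideal_congr.

Definition quotient_pi (x : A) : quotient := ba_pi d (x : bc_sort ideal_congr).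

HB.instance Definition _ := isBAHom.Build d A d quotient quotient_pi
  (@ba_piI d ideal_congr) (@ba_piU d ideal_congr) erefl erefl.

Lemma quotient_piP x y : quotient_pi x = quotient_pi y <-> ideal_eq x y.
Proof. exact: ba_piP. Qed.

Lemma quotient_pi_surj (z : quotient) : exists x, quotient_pi x = z.
Proof. by exists (ba_repr z); apply: ba_reprK. Qed.

Lemma quotient_pi0 x : quotient_pi x = \bot <-> ideal_set I x.
Proof.
have -> : \bot = quotient_pi \bot by [].
rewrite quotient_piP /ideal_eq compl0 meetx1 meet0x.
by split=> [[]//|Ix]; split=> //; case: (idealP I).
Qed.

Lemma quotient_lift d' (C : ctbDistrLatticeType d') (f : {bahom A -> C}) :
    (forall x, ideal_set I x -> f x = \bot) ->
  exists h : {bahom quotient -> C}, forall x, h (quotient_pi x) = f x.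
Proof.
move=> fI; pose h (z : quotient) := f (ba_repr z : A).
have f_eq x y : ideal_eq x y -> f x = f y.
  have le x' y' : ideal_set I (x' `&` ~` y') -> f x' <= f y'.
    move=> /fI; rewrite omorphI /= bahomC => fxy.
    by rewrite -[f x']meetx1 -(joinxC (f y')) meetUr fxy joinx0 leIr.
  by move=> [xy yx]; apply: le_anti; rewrite !le.
have hE x : h (quotient_pi x) = f x by apply: f_eq; exact: (@ba_repr_pi d ideal_congr x).
have hI : {morph h : x y / x `&` y}.
  move=> z w; have [x <-] := quotient_pi_surj z; have [y <-] := quotient_pi_surj w.
  by rewrite -omorphI !hE omorphI.
have hU : {morph h : x y / x `|` y}.
  move=> z w; have [x <-] := quotient_pi_surj z; have [y <-] := quotient_pi_surj w.
  by rewrite -omorphU !hE omorphU.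
have h0 : h \bot = \bot by rewrite -[\bot]/(quotient_pi \bot) hE omorph0.
have h1 : h \top = \top by rewrite -[\top]/(quotient_pi \top) hE omorph1.
pose H := isBAHom.Build _ _ _ _ h hI hU h0 h1.
pose hh : {bahom quotient -> C} := HB.pack h H.
by exists hh.
Qed.

End Quotient.

(** ** Coproducts (free products)

    Formal Boolean combinations of elements of the [A i], identified when they
    agree under every family of homomorphisms from the [A i] to a common
    Boolean algebra.  [coprod_lift] and [coprod_hom_uniq] are the universal
    property. *)

Section Coproduct.
Variables (d : Order.disp_t) (I : Type) (A : I -> ctbDistrLatticeType d).

Inductive coprod_term : Type :=
| CGen i of A i
| CBot
| CTop
| CCompl of coprod_term
| CMeet of coprod_term & coprod_term
| CJoin of coprod_term & coprod_term.

Fixpoint coprod_eval d' (C : ctbDistrLatticeType d')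
    (f : forall i, {bahom A i -> C}) (t : coprod_term) : C :=
  match t with
  | CGen i a => f i a
  | CBot => \bot
  | CTop => \top
  | CCompl s => ~` coprod_eval f s
  | CMeet s u => coprod_eval f s `&` coprod_eval f u
  | CJoin s u => coprod_eval f s `|` coprod_eval f u
  end.

Definition coprod_eq (s t : coprod_term) : Prop :=
  forall d' (C : ctbDistrLatticeType d') (f : forall i, {bahom A i -> C}),
    coprod_eval f s = coprod_eval f t.

Definition coprod_congr : ba_congr.
Proof.
refine {| bc_eq := coprod_eq; bc_bot := CBot; bc_top := CTop; bc_compl := CCompl;
          bc_meet := CMeet; bc_join := CJoin |} => //.
- by move=> s t st d' C f; rewrite st.
- by move=> s t u st tu d' C f; rewrite st tu.
- by move=> s s' ss' d' C f /=; rewrite ss'.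
- by move=> s s' t t' ss' tt' d' C f /=; rewrite ss' tt'.
- by move=> s s' t t' ss' tt' d' C f /=; rewrite ss' tt'.
- by move=> s t d' C f /=; apply: meetC.
- by move=> s t d' C f /=; apply: joinC.
- by move=> s t u d' C f /=; apply: meetA.
- by move=> s t u d' C f /=; apply: joinA.
- by move=> s t d' C f /=; apply: joinKI.
- by move=> s t d' C f /=; apply: meetKU.
- by move=> s t u d' C f /=; apply: meetUl.
- by move=> s d' C f /=; apply: meetxC.
- by move=> s d' C f /=; apply: joinxC.
Defined.

Definition coprod : ctbDistrLatticeType d := ba_quot d coprod_congr.

Let pi (t : coprod_term) : coprod := ba_pi d (t : bc_sort coprod_congr).

Definition cofactor (i : I) (a : A i) : coprod := pi (CGen a).

Section Cofactor.
Variable i : I.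

Fact cofactorI : {morph @cofactor i : a b / a `&` b}.
Proof.
move=> a b; rewrite -(@ba_piI d coprod_congr); apply/ba_piP => d' C f /=.
exact: omorphI.
Qed.

Fact cofactorU : {morph @cofactor i : a b / a `|` b}.
Proof.
move=> a b; rewrite -(@ba_piU d coprod_congr); apply/ba_piP => d' C f /=.
exact: omorphU.
Qed.

Fact cofactor0 : @cofactor i \bot = \bot.
Proof. by apply/ba_piP => d' C f /=; apply: omorph0. Qed.

Fact cofactor1 : @cofactor i \top = \top.
Proof. by apply/ba_piP => d' C f /=; apply: omorph1. Qed.

HB.instance Definition _ := isBAHom.Build d (A i) d coprod (@cofactor i)
  cofactorI cofactorU cofactor0 cofactor1.

End Cofactor.

Lemma coprod_lift d' (C : ctbDistrLatticeType d')
    (f : forall i, {bahom A i -> C}) :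
  exists h : {bahom coprod -> C}, forall i (a : A i), h (cofactor a) = f i a.
Proof.
pose h (z : coprod) : C := coprod_eval f (ba_repr z).
have hE t : h (pi t) = coprod_eval f t by apply: (ba_repr_pi d (t : bc_sort coprod_congr)).
have hI : {morph h : x y / x `&` y}.
  elim/ba_quotW => s; elim/ba_quotW => t.
  by rewrite -ba_piI [LHS]hE /= -!hE.
have hU : {morph h : x y / x `|` y}.
  elim/ba_quotW => s; elim/ba_quotW => t.
  by rewrite -ba_piU [LHS]hE /= -!hE.
have h0 : h \bot = \bot by exact: (hE CBot).
have h1 : h \top = \top by exact: (hE CTop).
pose H := isBAHom.Build _ _ _ _ h hI hU h0 h1.
pose hh : {bahom coprod -> C} := HB.pack h H.
by exists hh => i a; apply: hE.
Qed.

Lemma coprod_hom_uniq d' (C : ctbDistrLatticeType d') (g h : {bahom coprod -> C}) :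
  (forall i (a : A i), g (cofactor a) = h (cofactor a)) -> g =1 h.
Proof.
move=> gh; elim/ba_quotW => t; elim: t => [i a|||s IHs|s IHs u IHu|s IHs u IHu].
- exact: gh.
- by rewrite -[ba_pi _ _]/(\bot : coprod) !omorph0.
- by rewrite -[ba_pi _ _]/(\top : coprod) !omorph1.
- by rewrite (@ba_piC d coprod_congr) !bahomC; congr (~` _).
- by rewrite (@ba_piI d coprod_congr) !omorphI; congr (_ `&` _).
- by rewrite (@ba_piU d coprod_congr) !omorphU; congr (_ `|` _).
Qed.

End Coproduct.

Arguments cofactor {d I A} i a.

(** ** Commuting subalgebras *)

Section Commuting.
Variables (d : Order.disp_t) (B : ctbDistrLatticeType d).
Variables (n : nat) (A : 'I_n -> subalgebra B).

Definition free_product : ctbDistrLatticeType d :=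
  coprod (fun i => subalg_type (A i) : ctbDistrLatticeType d).

Definition free_product_incl (i : 'I_n) (a : subalg_type (A i)) : free_product :=
  cofactor (A := fun i => subalg_type (A i) : ctbDistrLatticeType d) i a.

(** A common element [z] of [A i] and [A j] is given by its two copies
    [a : subalg_type (A i)] and [b : subalg_type (A j)]. *)
Definition amalgamation_ideal : ideal free_product :=
  gen_ideal [set x | exists i j (a : subalg_type (A i)) (b : subalg_type (A j)),
    (a : B) = (b : B) /\
    x = free_product_incl a `&` free_product_incl (~` b)].

Definition amalgam : ctbDistrLatticeType d := quotient amalgamation_ideal.

Definition is_canonical_hom (h : {bahom amalgam -> B}) : Prop :=
  forall i (a : subalg_type (A i)),
    h (quotient_pi amalgamation_ideal (free_product_incl a)) = (a : B).

Lemma canonical_hom_exists : exists h, is_canonical_hom h.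
Proof.
have [g gE] := @coprod_lift d _ (fun i => subalg_type (A i) : ctbDistrLatticeType d)
  d B (fun i => @subalg_val _ _ (A i) : {bahom _ -> _}).
have [|h hE] := @quotient_lift _ _ amalgamation_ideal _ _ g.
  pose K : set free_product := [set x | g x = \bot].
  have KI : is_ideal K.
    split; rewrite /K /=; first exact: omorph0.
      by move=> x y xy gy; apply/eqP; rewrite -lex0 -gy; apply: omorph_le.
    by move=> x y gx gy; rewrite omorphU /= gx gy join0x.
  apply: (smallest_sub KI) => _ [i [j [a [b [ab ->]]]]].
  rewrite /K /= omorphI /= /free_product_incl !gE /= ab.
  by rewrite meetxC.
by exists h => i a; rewrite hE; apply: gE.
Qed.

Lemma canonical_hom_uniq (g h : {bahom amalgam -> B}) :
  is_canonical_hom g -> is_canonical_hom h -> g =1 h.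
Proof.
move=> gP hP z; have [x <-] := quotient_pi_surj z.
pose gpi : {bahom free_product -> B} := g \o quotient_pi amalgamation_ideal.
pose hpi : {bahom free_product -> B} := h \o quotient_pi amalgamation_ideal.
by apply: (coprod_hom_uniq (g := gpi) (h := hpi)) => i a; rewrite /= gP hP.
Qed.

Definition commute : Prop :=
  exists2 h : {bahom amalgam -> B}, is_canonical_hom h & injective h.

End Commuting.

(** ** Ordinals up to [omega] *)

Variant ord_le_omega := Fin of nat | Omega.

Definition nat_lt_ord (n : nat) (d : ord_le_omega) : Prop :=
  if d is Fin m then (n < m)%N else True.

Definition nat_le_ord (n : nat) (d : ord_le_omega) : Prop :=
  if d is Fin m then (n <= m)%N else True.

(** Ordinal sum [1 + d], so that [1 + omega = omega]. *)
Definition one_add (d : ord_le_omega) : ord_le_omega :=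
  if d is Fin m then Fin (1 + m) else Omega.

(** ** The [d]-ary SFN *)

Definition has_SFN (d : ord_le_omega) disp (A : ctbDistrLatticeType disp) : Prop :=
  exists E : set (subalgebra A),
    [/\ forall S, E S -> finite_set S,
        forall F : subalgebra A, finite_set F -> exists2 S, E S & F `<=` S &
        forall n (B : 'I_n -> subalgebra A),
          nat_lt_ord n (one_add d) -> (forall i, E (B i)) -> commute B].

(** ** The [d]-ary FN *)

Definition is_club (T : Type) (E : set (set T)) : Prop :=
  [/\ forall X, E X -> countable X,
      forall X, countable X -> exists2 Y, E Y & X `<=` Y &
      forall C : set (set T), C `<=` E -> countable C -> C !=set0 ->
        total_on C subset -> E (\bigcup_(X in C) X)].

Definition relatively_complete disp (A : ctbDistrLatticeType disp)
    (B : subalgebra A) : Prop :=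
  forall y, exists x, [/\ (B : set A) x, x <= y &
    forall z, (B : set A) z -> z <= y -> z <= x].

Definition has_FN (d : ord_le_omega) disp (A : ctbDistrLatticeType disp) : Prop :=
  exists2 E : set (set A), is_club E &
    forall n (X : 'I_n -> set A), nat_lt_ord n d -> (forall i, E (X i)) ->
      relatively_complete (gen_subalg (\bigcup_i X i)).

(* Main.v *)
(** A tuple of finite subalgebras commutes iff every choice of ultrafilters on
    them that agree on the pairwise intersections has nonzero meets.

    Projective implies SFN: [A] is a retract of a free algebra, where the
    subalgebra generated by any set of generators is relatively complete.  Hence
    [gen_subalg T] is relatively complete for every [T] closed under a map with
    finite values, and [A] has a well-ordering whose initial segments all
    generate relatively complete subalgebras.  Take the subalgebras generated by
    finite sets [f] that, with each [a], capture the lower projections of [a]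
    and [~` a] to the segment below [a].  Given compatible ultrafilters on such
    subalgebras, a nonzero lower bound [x] is built by adding the generators in
    increasing order: if adding [e] gave [x `&` e = \bot], then [x] would be
    below the projection of [~` e], which lies in a subalgebra whose ultrafilter
    contains [e].

    SFN implies FN: take the countable unions of directed subfamilies of the SFN
    family.  To project [y] to the algebra generated by [X_0, ..., X_(n-1)], fix
    [S] in the family with [y] in [S], and [R_i] in the family inside [X_i] with
    [S `&` X_i] included in [R_i].  The projection of [y] to the finite algebra
    generated by the [R_i] is the largest element sought, because [S] commutes
    with all larger members [R'_i] of the family inside [X_i]. *)

Require Import Defs.
From HB Require Import structures.
From mathcomp Require Import all_boot all_order.
From mathcomp Require Import boolp classical_sets cardinality wochoice.

Set Implicit Arguments.
Unset Strict Implicit.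
Unset Printing Implicit Defensive.

Import Order.Theory.

Local Open Scope classical_set_scope.
Local Open Scope order_scope.

Local Notation gen X := (subalg_set (gen_subalg X)).

(** * Boolean identities, elements deciding finite sets, generated subalgebras *)

Section BooleanAlgebra.
Variables (d : Order.disp_t) (A : ctbDistrLatticeType d).
Implicit Types (x y z q : A) (X Y : set A).

Lemma le_meetC_bot x y : (x <= y) = (x `&` ~` y == \bot).
Proof.
apply/idP/eqP => [xy|xy0].
  by apply/eqP; rewrite -lex0 -(meetxC y) leI2.
by rewrite -[x]meetx1 -(joinxC y) meetUr xy0 joinx0 leIr.
Qed.

Lemma le_compl_meet x y : (x <= ~` y) = (x `&` y == \bot).
Proof. by rewrite le_meetC_bot complK. Qed.

Lemma le_joinC x y z : (x `&` y <= z) = (x <= z `|` ~` y).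
Proof.
by rewrite [LHS]le_meetC_bot [RHS]le_meetC_bot complU complK -meetA [~` z `&` y]meetC.
Qed.

Lemma eq_bot_le_compl x y : x <= y -> x <= ~` y -> x = \bot.
Proof. by move=> xy xCy; apply/eqP; rewrite -lex0 -(meetxC y) lexI xy. Qed.

Lemma subalgebraI X x y : is_subalgebra X -> X x -> X y -> X (x `&` y).
Proof. by case=> _ _ _ + _; apply. Qed.

Lemma subalgebraC X x : is_subalgebra X -> X x -> X (~` x).
Proof. by case=> _ _ + _ _; apply. Qed.

Lemma subalgebra_weak X : X \bot -> (forall x, X x -> X (~` x)) ->
  (forall x y, X x -> X y -> X (x `&` y)) -> is_subalgebra X.
Proof.
move=> X0 XC XI; split=> //; first by rewrite -compl0; apply: XC.
by move=> x y Xx Xy; rewrite -[_ `|` _]complK complU; apply/XC/XI; apply: XC.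
Qed.

Lemma sub_gen X : X `<=` gen X.
Proof. exact: sub_smallest. Qed.

Lemma gen_sub X Y : is_subalgebra Y -> X `<=` Y -> gen X `<=` Y.
Proof. exact: smallest_sub. Qed.

Lemma genS X Y : X `<=` Y -> gen X `<=` gen Y.
Proof. by move=> XY; apply: gen_sub (subalgP _) (subset_trans XY (@sub_gen Y)). Qed.

(* A nonzero [q] deciding a subalgebra encodes the ultrafilter
   [set x | q <= x] on it; this avoids the prime ideal theorem. *)

Definition decides q X := q != \bot /\ forall x, X x -> q <= x \/ q <= ~` x.

(** Run through an enumeration of [X], meeting the current element with [y] when that is nonzero;
    otherwise it is already below the complement of [y]. *)
Lemma decides_exists X x : finite_set X -> x != \bot ->
  exists2 q, q <= x & decides q X.
Proof.
move=> /finite_seqP[s ->] {X}; elim: s x => [|y s IHs] x x0.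
  by exists x => //; split.
have split_x : x = (x `&` y) `|` (x `&` ~` y) by rewrite -meetUr joinxC meetx1.
have [z [z0 zx zy]] : exists z, [/\ z != \bot, z <= x & z <= y \/ z <= ~` y].
  have [xy0|xy0] := eqVneq (x `&` y) \bot.
    exists x; split=> //; right.
    by rewrite le_compl_meet xy0.
  by exists (x `&` y); rewrite leIl leIr; split=> //; left.
have [q qz [q0 qs]] := IHs z z0.
exists q; first exact: le_trans zx.
split=> // t; rewrite /= inE => /orP[/eqP->|/qs//].
by case: zy => zy; [left|right]; apply: le_trans zy.
Qed.

Lemma finite_has_least X : finite_set X -> X !=set0 ->
  (forall x y, X x -> X y -> X (x `&` y)) ->
  exists2 q, X q & forall x, X x -> q <= x.
Proof.
move=> /finite_seqP[s Xs] [x0 Xx0] XI.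
suff [q Xq qs] : exists2 q, X q & forall x, x \in s -> X x -> q <= x.
  by exists q => // x Xx; apply: qs => //; move: Xx; rewrite Xs.
elim: s {Xs} => [|y s [q Xq qs]]; first by exists x0.
have [Xy|nXy] := pselect (X y).
  exists (y `&` q); first exact: XI.
  move=> x; rewrite inE => /orP[/eqP-> _|xs Xx]; first exact: leIl.
  exact: le_trans (leIr _ _) (qs _ xs Xx).
exists q => // x; rewrite inE => /orP[/eqP->//|]; exact: qs.
Qed.

Lemma finite_has_greatest X : finite_set X -> X !=set0 ->
  (forall x y, X x -> X y -> X (x `|` y)) ->
  exists2 q, X q & forall x, X x -> x <= q.
Proof.
move=> finX [x Xx] XU.
have [||y z [y' Xy' <-] [z' Xz' <-]|q [q' Xq' <-] qle] :=
  @finite_has_least ((fun x => ~` x) @` X).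
- exact: finite_image.
- by exists (~` x); exists x.
- by exists (y' `|` z'); [exact: XU | rewrite complU].
by exists q' => // y Xy; rewrite -leC; apply: qle; exists y.
Qed.

(* The element found is the atom of [X] determined by [q]. *)
Lemma decides_atom X q : is_subalgebra X -> finite_set X -> q != \bot ->
  decides q X ->
  exists r, [/\ X r, q <= r & forall x, X x -> q <= x -> r <= x].
Proof.
move=> [X0 X1 XC XI XU] finX q0 [_ qX].
have [|||r [Xr qr] rle] := @finite_has_least [set x | X x /\ q <= x].
- by apply: sub_finite_set finX => x [].
- by exists \top; split; rewrite ?lex1.
- by move=> x y [Xx qx] [Xy qy]; split; [exact: XI | rewrite lexI qx].
by exists r; split=> // x Xx qx; apply: rle.
Qed.

Lemma gen_adjoin X x z : gen (X `|` [set x]) z ->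
  exists a b, [/\ gen X a, gen X b &
    z = (a `&` x) `|` (b `&` ~` x)].
Proof.
have [X0 X1 XC XI XU] := subalgP (gen_subalg X).
(* The normal form is split into agreement with [a] below [x] and with [b] below its complement,
   since complements and meets preserve each agreement separately. *)
pose Z := [set z | exists a b, [/\ gen X a, gen X b &
    z `&` x = a `&` x /\ z `&` ~` x = b `&` ~` x]].
suff ZX : gen (X `|` [set x]) `<=` Z.
  move=> /ZX[a [b [Xa Xb [zx zCx]]]]; exists a, b; split=> //.
  by rewrite -zx -zCx -meetUr joinxC meetx1.
have ZC (u v w : A) : u `&` w = v `&` w -> ~` u `&` w = ~` v `&` w.
  move=> uv; rewrite -[LHS]joinx0 -(meetCx w) -meetUl -complI meetC.
  by rewrite -[RHS]joinx0 -(meetCx w) -meetUl -complI uv meetC.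
have ZI (u u' v v' w : A) : u `&` w = u' `&` w -> v `&` w = v' `&` w ->
    u `&` v `&` w = u' `&` v' `&` w.
  by move=> uw vw; rewrite -[w]meetxx meetACA uw vw meetACA.
apply: gen_sub; first apply: subalgebra_weak.
- by exists \bot, \bot; split.
- move=> u [a [b [Xa Xb [ua ub]]]]; exists (~` a), (~` b).
  by split; [exact: XC..|split; apply: ZC].
- move=> u v [a [b [Xa Xb [ua ub]]]] [a' [b' [Xa' Xb' [va vb]]]].
  by exists (a `&` a'), (b `&` b'); split; [exact: XI..|split; apply: ZI].
move=> u [Xu|->]; last by exists \top, \bot; rewrite meetxx meetxC meet1x meet0x.
by exists u, u; split=> //; apply: sub_gen.
Qed.

Lemma finite_gen X : finite_set X -> finite_set (gen X).
Proof.
move=> /finite_seqP[s ->] {X}; elim: s => [|x s IHs].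
  apply: (@sub_finite_set _ _ [set \bot; \top]); last exact: finite_set2.
  apply: gen_sub => //; apply: subalgebra_weak; first by left.
    by move=> x [->|->]; rewrite ?compl0 ?compl1; [right|left].
  by move=> x y [->|->] [->|->]; rewrite ?meet0x ?meet1x; [left..|right].
pose f (p : A * A) := (p.1 `&` x) `|` (p.2 `&` ~` x).
apply: (@sub_finite_set _ _
  (f @` (gen [set` s] `*` gen [set` s]))); last first.
  by apply/finite_image/finite_setX.
have -> : [set` x :: s] = [set` s] `|` [set x].
  by apply/seteqP; split=> y /=; rewrite inE;
    [case/orP => [/eqP|]; [right|left] | case=> [->|->]; rewrite ?eqxx ?orbT].
by move=> z /gen_adjoin[a [b [Xa Xb ->]]]; exists (a, b).
Qed.

Lemma gen_bigcup_finite I (D : set I) (Y : I -> set A) z :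
  gen (\bigcup_(i in D) Y i) z ->
  exists E, [/\ finite_set E, E `<=` D & gen (\bigcup_(i in E) Y i) z].
Proof.
move: z; apply: gen_sub; first apply: subalgebra_weak.
- by exists set0; split=> //; case: (subalgP (gen_subalg (\bigcup_(i in set0) Y i))).
- by move=> z [E [finE ED Ez]]; exists E; split=> //; apply: subalgebraC (subalgP _) _.
- move=> z w [E [finE ED Ez]] [F [finF FD Fw]]; exists (E `|` F); split.
  + by rewrite finite_setU.
  + by move=> i [/ED|/FD].
  + apply: subalgebraI (subalgP _) _ _.
      by apply: genS Ez => x [i Ei Yx]; exists i => //; left.
    by apply: genS Fw => x [i Fi Yx]; exists i => //; right.
move=> x [i Di Yx]; exists [set i]; split=> //; first by move=> _ ->.
by apply: sub_gen; exists i.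
Qed.

Lemma gen_finite X z : gen X z ->
  exists G, [/\ finite_set G, G `<=` X & gen G z].
Proof.
have XE : X = \bigcup_(x in X) [set x].
  by apply/seteqP; split=> [x Xx|x [y Xy ->]//]; exists x.
rewrite [in X in X -> _]XE.
move=> /gen_bigcup_finite[G [finG GX Gz]]; exists G; split=> //.
by apply: genS Gz => x [y Gy ->].
Qed.

End BooleanAlgebra.

(** Transfers information from generators: it is enough to check on them that [x] takes, on [h a],
    the side that [q] takes on [a]. *)
Lemma agree_subalgebra d (A : ctbDistrLatticeType d) d' (B : ctbDistrLatticeType d')
    (h : {bahom A -> B}) (q : A) (x : B) :
  is_subalgebra [set a | q <= a /\ x <= h a \/ q <= ~` a /\ x <= ~` h a].
Proof.
apply: subalgebra_weak => /=.
- by right; rewrite omorph0 !compl0 !lex1.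
- by move=> a; rewrite complK bahomC complK => -[?|?]; [right|left].
- move=> a b; rewrite omorphI /= => -[[qa xa]|[qa xa]] [[qb xb]|[qb xb]].
  + by left; rewrite !lexI qa qb xa.
  all: by right; rewrite !complI !lexU2 ?qa ?qb ?xa ?xb ?orbT.
Qed.

Section Agree.
Variables (d : Order.disp_t) (A : ctbDistrLatticeType d).
Implicit Types (q x a : A) (X : set A).

Lemma agree_gen q x X : (forall a, X a -> q <= a /\ x <= a \/ q <= ~` a /\ x <= ~` a) ->
  forall a, gen X a -> q <= a /\ x <= a \/ q <= ~` a /\ x <= ~` a.
Proof. exact: (gen_sub (agree_subalgebra (idfun : {bahom A -> A}) q x)). Qed.

Lemma decides_gen q X : decides q X -> decides q (gen X).
Proof.
move=> [q0 qX]; split=> // a /(@agree_gen q q) [b|[]|[]] //; last 2 first.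
- by left.
- by right.
by move=> /qX[]; [left|right].
Qed.

Lemma decides_sub q X Y : X `<=` Y -> decides q Y -> decides q X.
Proof. by move=> XY [q0 qY]; split=> // x /XY/qY. Qed.

Lemma decidesN q X a : decides q X -> X a -> ~~ (q <= a) -> q <= ~` a.
Proof. by move=> [_ qX] /qX[->|]. Qed.

End Agree.

Lemma preimage_subalgebra d (A : ctbDistrLatticeType d) d' (B : ctbDistrLatticeType d')
    (h : {bahom A -> B}) (Y : set B) :
  is_subalgebra Y -> is_subalgebra (h @^-1` Y).
Proof.
move=> [Y0 Y1 YC YI YU]; apply: subalgebra_weak => /=.
- by rewrite omorph0.
- by move=> x Yx; rewrite bahomC; apply: YC.
- by move=> x y Yx Yy; rewrite omorphI; apply: YI.
Qed.

Definition cofactor_hom d (I : Type) (A : I -> ctbDistrLatticeType d) i :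
  {bahom A i -> coprod A} := @cofactor d I A i.

Lemma coprod_subalgebra d (I : Type) (A : I -> ctbDistrLatticeType d)
    (X : set (coprod A)) :
  is_subalgebra X -> (forall i (a : A i), X (cofactor i a)) -> forall z, X z.
Proof.
move=> [X0 X1 XC XI XU] Xgen; elim/ba_quotW.
elim=> [i a|||s Xs|s Xs t Xt|s Xs t Xt].
- exact: Xgen.
- exact: X0.
- exact: X1.
- by rewrite (@ba_piC d (coprod_congr A)); apply: XC.
- by rewrite (@ba_piI d (coprod_congr A)); apply: XI.
- by rewrite (@ba_piU d (coprod_congr A)); apply: XU.
Qed.

Section SubalgebraElements.
Variables (d : Order.disp_t) (A : ctbDistrLatticeType d) (X : subalgebra A).

Lemma subalg_valP (a : subalg_type X) : subalg_set X (subalg_val a).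
Proof. by case: a => a /= /asboolP. Qed.

Lemma mem_subalg_val x : subalg_set X x -> exists a : subalg_type X, subalg_val a = x.
Proof.
by move=> Xx; have px : subalg_pred X x by [apply/asboolP]; exists (SubalgElt px).
Qed.

End SubalgebraElements.

(** * A criterion for commuting *)

Section CommuteCriterion.
Variables (d : Order.disp_t) (B : ctbDistrLatticeType d).
Variables (n : nat) (S : 'I_n -> subalgebra B).

(** The ultrafilters coded by the [q i] agree on pairwise intersections; one implication suffices,
    as [i] and [j] range over all ordered pairs. *)
Definition compatible (q : 'I_n -> B) := forall i j z,
  subalg_set (S i) z -> subalg_set (S j) z -> q i <= z -> q j <= z.

(** Turns the ultrafilter coded by [q] into a two-valued homomorphism, to which the universal
    property of the coproduct applies. *)
Lemma decides_hom (X : subalgebra B) (q : B) : decides q X ->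
  exists f : {bahom subalg_type X -> bool},
    forall a, f a = (q <= subalg_val a).
Proof.
move=> qX; pose f (a : subalg_type X) : bool := q <= subalg_val a.
have fI : {morph f : x y / x `&` y} by move=> x y; rewrite /f subalg_valI lexI.
have f0 : f \bot = \bot by rewrite /f lex0; apply/negbTE; case: qX.
have f1 : f \top = \top by rewrite /f lex1.
have fU : {morph f : x y / x `|` y}.
  move=> x y; apply/idP/idP; rewrite /f subalg_valU; last first.
    by move=> xy; apply: lexU2.
  move=> qxy; apply/orP; case: (boolP (q <= subalg_val x)) => [|nx]; first by left.
  case: (boolP (q <= subalg_val y)) => [|ny]; first by right.
  have [q0 _] := qX; case/eqP: q0; apply: eq_bot_le_compl qxy _.
  by rewrite complU lexI !(decidesN qX) //; apply: subalg_valP.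
pose H := isBAHom.Build _ _ _ _ f fI fU f0 f1.
by pose g : {bahom subalg_type X -> bool} := HB.pack f H; exists g.
Qed.

(** The two-valued homomorphisms of the [q i] induce [g] on the free product. By compatibility [g]
    kills the amalgamation ideal, but not the meet of the copies of the [a i]; so this meet is
    nonzero in the amalgam and, by injectivity, in [B]. *)
Lemma commute_meet_neq0 (q a : 'I_n -> B) :
  Defs.commute S -> (forall i, decides (q i) (S i)) -> compatible q ->
  (forall i, subalg_set (S i) (a i) /\ q i <= a i) ->
  exists2 x, x != \bot & forall i, x <= a i.
Proof.
move=> [h hE h_inj] qS compat aS.
pose f i := projT1 (cid (decides_hom (qS i))).
have fE i : forall a, f i a = (q i <= subalg_val a) := projT2 (cid (decides_hom (qS i))).
have [g gE] := coprod_lift f.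
have Sb i := cid (mem_subalg_val (aS i).1).
pose b i := projT1 (Sb i); have bE i : subalg_val (b i) = a i := projT2 (Sb i).
pose m := \meet_i free_product_incl (b i).
have gm : g m = true.
  apply: (big_ind (fun u => g u = true)); first exact: omorph1.
    by move=> u v gu gv; rewrite omorphI /= gu gv.
  by move=> i _; rewrite gE fE bE; case: (aS i).
have gI u : ideal_set (amalgamation_ideal S) u -> g u = false.
  move: u; apply: smallest_sub; first split.
  - exact: omorph0.
  - move=> x y xy gy; apply/negbTE/negP => gx.
    by have := omorph_le g xy; rewrite /= gx gy.
  - by move=> x y gx gy; rewrite /= omorphU /= gx gy.
  move=> _ [i [j [u [v [uv ->]]]]]; rewrite /= omorphI /=.
  rewrite [g (free_product_incl u)]gE [g (free_product_incl _)]gE !fE.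
  apply/negbTE/negP => /andP[qu qv].
  have [q0 _] := qS j; case/eqP: q0.
  apply: (@eq_bot_le_compl _ _ _ (subalg_val v)) => //.
  by rewrite -uv; apply: compat qu; [|rewrite uv]; exact: subalg_valP.
exists (h (quotient_pi _ m)) => [|i]; last first.
  by rewrite -bE -hE; do 2!apply: omorph_le; apply: meets_inf.
apply/eqP; rewrite -[\bot](omorph0 h) => /h_inj/quotient_pi0/gI.
by rewrite gm.
Qed.

(** Below a nonzero [x] in the kernel there is a [q] deciding the copies of all factors. The atoms
    that [q] selects are compatible, and a nonzero [y] below them all behaves under [h] as [q] does
    in the amalgam; then [q <= x] forces [y <= h x], which is [\bot]. *)
Lemma commute_of_meet_neq0 :
  (forall i, finite_set (S i)) ->
  (forall q : 'I_n -> B,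
    (forall i, subalg_set (S i) (q i) /\ decides (q i) (S i)) -> compatible q ->
    exists2 x, x != \bot & forall i, x <= q i) ->
  Defs.commute S.
Proof.
move=> finS meetS; have [h hE] := canonical_hom_exists S.
exists h => //.
suff h0 x : h x = \bot -> x = \bot.
  move=> x y hxy; apply: le_anti; rewrite !le_meetC_bot.
  by apply/andP; split; apply/eqP/h0; rewrite omorphI /= bahomC hxy meetxC.
pose incl i : {bahom subalg_type (S i) -> free_product S} :=
  cofactor_hom (fun j => subalg_type (S j) : ctbDistrLatticeType d) i.
pose proj : {bahom free_product S -> amalgam S} :=
  quotient_pi (amalgamation_ideal S).
pose pi i : {bahom subalg_type (S i) -> amalgam S} := proj \o incl i.
move=> hx0; apply/eqP/negPn/negP => x0.
pose gens := \bigcup_i (range (pi i)).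
have [q qx qgens] : exists2 q, q <= x & decides q gens.
  apply: decides_exists x0; apply: bigcup_finite; first exact: finite_finset.
  move=> i _; apply: finite_image.
  apply: sub_finite_set (finite_image (insubd (\bot : subalg_type (S i))) (finS i)).
  by move=> a _; exists (subalg_val a); [exact: subalg_valP|exact: valKd].
have q0 : q != \bot by case: qgens.
have piC i (a : subalg_type (S i)) : pi i (~` a) = ~` pi i a.
  exact: bahomC.
have qpi i (a : subalg_type (S i)) : q <= pi i a \/ q <= ~` pi i a.
  by apply: (proj2 qgens); exists i => //; exists a.
(* [r i] is the least element of [S i] whose copy lies above [q], that is, the atom selected by
   [q]. *)
have /choice[r rP] i : exists r, [/\ (exists2 a, subalg_val a = r & q <= pi i a) &
    forall a, q <= pi i a -> r <= subalg_val a].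
  have [|||r qr rmin] :=
    @finite_has_least _ _ (@subalg_val _ _ (S i) @` [set a | q <= pi i a]).
  - by apply: sub_finite_set (finS i) => _ [a _ <-]; apply: subalg_valP.
  - exists \top; exists \top; last exact: subalg_val1.
    by rewrite /mkset (omorph1 (pi i)) lex1.
  - rewrite /mkset => _ _ [a qa <-] [b qb <-]; exists (a `&` b).
      rewrite (omorphI (pi i)) lexI.
      by rewrite qa qb.
    exact: subalg_valI.
  exists r; split; first by case: qr => a qa <-; exists a.
  by move=> a qa; apply: rmin; exists a.
have rS i : decides (r i) (S i).
  have [[a ra qa] rmin] := rP i; split.
    apply: contra_neq q0 => r0; apply/eqP; rewrite -lex0.
    have a0 : a = \bot by apply: subalg_val_inj; rewrite ra r0.
    by move: qa; rewrite a0 (omorph0 (pi i)).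
  move=> z /mem_subalg_val[b <-]; case: (qpi i b) => qb; [left|right].
    exact: rmin.
  by apply: (rmin (~` b)); rewrite piC.
have rE i (a : subalg_type (S i)) : r i <= subalg_val a -> q <= pi i a.
  case: (qpi i a) => qa ra; first exact: qa.
  have [r0 _] := rS i.
  case/eqP: r0; apply: eq_bot_le_compl ra _.
  by have [_ rmin] := rP i; apply: (rmin (~` a)); rewrite piC.
have r_compat : compatible r.
  move=> i j z /mem_subalg_val[a az] /mem_subalg_val[b bz] rz.
  have qa : q <= pi i a by apply: rE; rewrite az.
  have [_ rmin] := rP j; rewrite -bz; apply: rmin.
  case: (qpi j b) => qb; first exact: qb.
  case/eqP: q0; apply/eqP.
  (* The amalgamation ideal identifies the two copies [a] and [b] of [z], so a nonzero [q] cannot be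
     below one and below the complement of the other. *)
  rewrite -lex0; suff <- : pi i a `&` pi j (~` b) = \bot by rewrite lexI qa piC.
  rewrite -[LHS](omorphI (quotient_pi (amalgamation_ideal S))); apply/quotient_pi0 => J [_ XJ].
  apply: XJ; exists i, j, a, b; split; [by rewrite az bz | reflexivity].
have rSS i : subalg_set (S i) (r i) /\ decides (r i) (S i).
  by split; [case: (rP i) => -[a <- _] _; exact: subalg_valP | exact: rS].
have [y y0 yr] := meetS r rSS r_compat.
have agree := agree_subalgebra h q y.
have {agree} agree z : q <= z /\ y <= h z \/ q <= ~` z /\ y <= ~` h z.
  have [u <-] := quotient_pi_surj z.
  apply: (coprod_subalgebra
    (preimage_subalgebra (quotient_pi (amalgamation_ideal S) : {bahom _ -> _}) agree)).
  move=> i a; rewrite /= hE; have [_ rmin] := rP i.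
  case: (qpi i a) => qa; [left|right]; split=> //.
    exact: le_trans (yr i) (rmin _ qa).
  by apply: le_trans (yr i) (rmin (~` a) _); rewrite piC.
case: (agree x) => -[qx' yx].
  by move: yx; rewrite hx0 lex0 (negbTE y0).
by case/eqP: q0; apply: eq_bot_le_compl qx qx'.
Qed.
End CommuteCriterion.

(** * The SFN implies the FN *)

Lemma finite_sub_chain (T : choiceType) (I : Type) (C : set I) (X : I -> set T) (F : set T) :
  C !=set0 -> (forall i j, C i -> C j -> X i `<=` X j \/ X j `<=` X i) ->
  finite_set F -> F `<=` \bigcup_(i in C) X i -> exists2 i, C i & F `<=` X i.
Proof.
move=> [i0 Ci0] totC /finite_seqP[s ->] {F}; elim: s => [|x s IHs] sC; first by exists i0.
have [|i Ci si] := IHs; first by move=> y ys; apply: sC; rewrite /= inE ys orbT.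
have [|j Cj xj] := sC x; first by rewrite /= inE eqxx.
have [ij|ji] := totC i j Ci Cj; [exists j => // | exists i => //].
all: by move=> y; rewrite /= inE => /orP[/eqP->|/si]; auto.
Qed.

Lemma countable_rank (T : Type) (X : set T) : countable X ->
  exists2 f : T -> nat, {in X &, injective f} &
    forall n, finite_set [set x | X x /\ (f x < n)%N].
Proof.
move=> /countable_injP[f f_inj]; exists f => //; elim=> [|n IHn].
  by apply: sub_finite_set (finite_set0 T) => x [].
have fin1 : finite_set [set x | X x /\ f x = n].
  have [[y [Xy fy]]|nX] := pselect (exists y, X y /\ f y = n).
    apply: sub_finite_set (finite_set1 y) => x [Xx fx].
    by apply: f_inj; rewrite ?inE // fx.
  by apply: sub_finite_set (finite_set0 T) => x Xx; case: nX; exists x.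
apply: (@sub_finite_set _ _
  ([set x | X x /\ (f x < n)%N] `|` [set x | X x /\ f x = n])).
  by move=> x [Xx]; rewrite ltnS leq_eqVlt => /orP[/eqP ?|?]; [right|left].
by rewrite finite_setU.
Qed.

Section SFN_FN.
Variables (d : ord_le_omega) (disp : Order.disp_t) (A : ctbDistrLatticeType disp).
Variable E : set (subalgebra A).
Hypothesis finE : forall S, E S -> finite_set S.
Hypothesis cofE : forall F : subalgebra A, finite_set F -> exists2 S, E S & F `<=` S.
Hypothesis commE : forall n (B : 'I_n -> subalgebra A),
  nat_lt_ord n (one_add d) -> (forall i, E (B i)) -> Defs.commute B.

(** The countable unions of directed subfamilies of [E]. Phrased by capturing finite subsets, since
    a finite subset of the union of a chain lies in one member. *)
Definition directed_unions : set (set A) := [set X | countable X /\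
  forall F, finite_set F -> F `<=` X -> exists S, [/\ E S, F `<=` S & S `<=` X]].

Lemma cofE_set (F : set A) : finite_set F -> exists2 S, E S & F `<=` S.
Proof.
move=> /finite_gen/cofE[S ES FS]; exists S => //.
exact: subset_trans (@sub_gen _ _ F) FS.
Qed.

Lemma directed_unions_club : is_club directed_unions.
Proof.
split; first by move=> X [].
  move=> X /countable_rank[f _ finX].
  have /choice[phi phiP] (F : set A) : exists S : subalgebra A,
      finite_set F -> E S /\ F `<=` S.
    have [finF|?] := pselect (finite_set F).
      by have [S] := cofE_set finF; exists S.
    by have [S] := cofE_set (finite_set0 A); exists S.
  pose Xn n := [set x | X x /\ (f x < n)%N].
  (* An increasing sequence in [E]: each stage contains the previous one and all elements of [X] of
     rank below its index, so the union covers [X]. *)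
  pose S := fix S n := if n is m.+1 then phi (subalg_set (S m) `|` Xn n) else phi set0.
  have ES n : E (S n).
    elim: n => [|n IHn] /=; first by case: (phiP _ (finite_set0 A)).
    by apply: (phiP _ _).1; rewrite finite_setU; split; [exact: finE|exact: finX].
  have phiS n : subalg_set (S n) `|` Xn n.+1 `<=` S n.+1.
    by apply: (phiP _ _).2; rewrite finite_setU; split; [exact/finE/ES|exact: finX].
  have S_mono m n : (m <= n)%N -> subalg_set (S m) `<=` S n.
    elim: n => [|n IHn]; first by rewrite leqn0 => /eqP ->.
    rewrite leq_eqVlt => /orP[/eqP -> //|/IHn mn].
    by apply: subset_trans mn _ => x Sx; apply: phiS; left.
  exists (\bigcup_n S n); last first.
    by move=> x Xx; exists (f x).+1 => //; apply: phiS; right; split.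
  split.
    by apply: bigcup_countable => [|n _]; [exact: countableP | exact/finite_set_countable/finE].
  move=> F finF FS; have [||n _ Fn] := @finite_sub_chain _ _ setT S F _ _ finF FS.
  - by exists 0%N.
  - by move=> m n _ _; case/orP: (leq_total m n) => /S_mono; [left|right].
  by exists (S n); split=> [||x Sx]; [exact: ES|exact: Fn|exists n].
move=> C CE countC C0 totC; split.
  by apply: bigcup_countable => // X /CE[].
move=> F finF FC; have [|X CX FX] := @finite_sub_chain _ _ C idfun F C0 _ finF FC.
  by move=> X Y CX CY; apply: totC.
have [_ /(_ F finF FX)[S [ES FS SX]]] := CE X CX.
by exists S; split=> // x /SX Xx; exists X.
Qed.

(** Maximality of [v] is by contradiction. If [w <= y] is not below [v], some [q] below [w] and
    disjoint from [v] decides the [R' i]. The atom [r] of [B0] above [q] is not below [y], so some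
    [p] below [r] and disjoint from [y] decides [S]. Commutation then gives a nonzero element below
    [w] and disjoint from [y]. *)
Lemma directed_unions_rc n (X : 'I_n -> set A) :
  nat_lt_ord n d -> (forall i, directed_unions (X i)) ->
  relatively_complete (gen_subalg (\bigcup_i X i)).
Proof.
move=> nd XE y.
have [S ES Sy] := cofE_set (finite_set1 y).
have {}Sy : subalg_set S y by apply: Sy.
have [_ _ SC _ _] := subalgP S.
(* The finite trace of [S] on [X i] goes into [R i], so that every later [R' i] meets [S] inside
   [B0]. *)
have /choice[R RP] i : exists R, [/\ E R, S `&` X i `<=` R & R `<=` X i].
  by apply: (XE i).2 => [|x []//]; apply/finite_setIl/finE.
pose B0 := gen (\bigcup_i (R i : set A)).
have finR : finite_set (\bigcup_i (R i : set A)).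
  apply: bigcup_finite; first exact: finite_finset.
  by move=> i _; case: (RP i) => /finE.
have [B00 B01 B0C B0I B0U] : is_subalgebra B0 := subalgP _.
have [|||v [B0v vy] vmax] := @finite_has_greatest _ _ [set x | B0 x /\ x <= y].
- by apply: sub_finite_set (finite_gen finR) => x [].
- by exists \bot; split; rewrite ?le0x.
- by move=> x z [Bx xy] [Bz zy]; split; [exact: B0U | rewrite leUx xy].
exists v; split=> //.
  by apply: genS B0v => x [i _ Rx]; exists i => //; case: (RP i) => _ _; apply.
move=> w Xw wy; apply/negPn/negP; rewrite le_meetC_bot => wv.
have [G [finG GX Gw]] := gen_finite Xw.
have /choice[R' R'P] i : exists R' : subalgebra A,
    [/\ E R', R i `|` (G `&` X i) `<=` R' & R' `<=` X i].
  have [ER _ RX] := RP i.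
  apply: (XE i).2; last by move=> x [/RX|[]].
  by rewrite finite_setU; split; [exact: finE | exact: finite_setIl].
have {Gw} R'w : gen (\bigcup_i (R' i : set A)) w.
  apply: genS Gw => x Gx; have [i _ Xx] := GX x Gx.
  by exists i => //; have [_ + _] := R'P i; apply; right.
have [|q qwv qR'] := @decides_exists _ _ (\bigcup_i (R' i : set A)) _ _ wv.
  apply: bigcup_finite; first exact: finite_finset.
  by move=> i _; case: (R'P i) => /finE.
have qw : q <= w by apply: le_trans qwv (leIl _ _).
have q0 : q != \bot by case: qR'.
have qB0 : decides q B0.
  apply: decides_gen; apply: decides_sub qR' => x [i _ Rx]; exists i => //.
  by have [_ + _] := R'P i; apply; left.
have [r [B0r qr rmin]] := decides_atom (subalgP _) (finite_gen finR) q0 qB0.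
(* If [r] were below [y], maximality in [B0] would put it below [v], but the nonzero [q] is below
   [r] and disjoint from [v]. *)
have ry : r `&` ~` y != \bot.
  rewrite -le_meetC_bot; apply: contraNN q0 => ry.
  apply/eqP/(@eq_bot_le_compl _ _ _ v).
    by apply: le_trans qr _; apply: vmax.
  exact: le_trans qwv (leIr _ _).
have [p pry pS] := decides_exists (finE ES) ry.
have pr : p <= r by apply: le_trans pry (leIl _ _).
(* Index [ord0] carries [S] and [p], the others [R'] and [q]. The length [n.+1] is below [one_add d]
   because [n] is below [d]. *)
pose B (i : 'I_n.+1) := oapp R' S (unlift ord0 i).
pose q' (i : 'I_n.+1) := oapp (fun=> q) p (unlift ord0 i).
have B_0 : B ord0 = S by rewrite /B unlift_none.
have B_S i : B (lift ord0 i) = R' i by rewrite /B liftK.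
have q_0 : q' ord0 = p by rewrite /q' unlift_none.
have q_S i : q' (lift ord0 i) = q by rewrite /q' liftK.
have EB i : E (B i).
  by case: (unliftP ord0 i) => [j|] ->; rewrite ?B_S ?B_0 //; case: (R'P j).
have commB : Defs.commute B by apply: commE EB; case: (d) nd.
have q'B i : decides (q' i) (B i).
  case: (unliftP ord0 i) => [j|] ->; rewrite ?B_S ?B_0 ?q_S ?q_0 //.
  by apply: decides_sub qR' => x R'x; exists j.
have B0SR' i z : subalg_set S z -> subalg_set (R' i) z -> B0 z.
  move=> Sz R'z; have [_ SXR _] := RP i.
  apply: sub_gen; exists i => //; apply: SXR; split=> //.
  by have [_ _] := R'P i; apply.
have q'_compat : compatible B q'.
  move=> i j z; case: (unliftP ord0 i) => [i'|] ->; case: (unliftP ord0 j) => [j'|] ->;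
    rewrite ?B_S ?B_0 ?q_S ?q_0 //.
  - move=> /[swap] /B0SR' /[apply] B0z qz; apply: le_trans pr _.
    exact: rmin.
  - move=> /B0SR' /[apply] B0z pz; apply/negPn/negP => /(decidesN qB0 B0z) qz.
    have [p0 _] := pS; case/eqP: p0; apply: eq_bot_le_compl pz _.
    by apply: le_trans pr (rmin _ _ qz); apply: B0C.
have /choice[a aP] i : exists a, [/\ subalg_set (R' i) a, q <= a &
    forall z, subalg_set (R' i) z -> q <= z -> a <= z].
  apply: decides_atom => //; [exact: subalgP | by case: (R'P i) => /finE |].
  by have := q'B (lift ord0 i); rewrite q_S B_S.
pose a' (i : 'I_n.+1) := oapp a (~` y) (unlift ord0 i).
have [i|x x0 xa'] := @commute_meet_neq0 _ _ _ _ q' a' commB q'B q'_compat.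
  rewrite /a' /B /q'; case: (unliftP ord0 i) => [j|] _ /=.
    by case: (aP j).
  by split; [exact: SC | exact: le_trans pry (leIr _ _)].
have xy : x <= ~` y by have := xa' ord0; rewrite /a' unlift_none.
have xa i : x <= a i by have := xa' (lift ord0 i); rewrite /a' liftK.
have [[_ xw]|[qCw _]] : q <= w /\ x <= w \/ q <= ~` w /\ x <= ~` w.
- apply: agree_gen R'w => z [i _ R'z]; have [R'a qa amin] := aP i.
  have [|qz] := boolP (q <= z); first by left; split=> //; apply: le_trans (amin _ _ _).
  have qCz : q <= ~` z by apply: decidesN qR' _ qz; exists i.
  right; split=> //; apply: le_trans (xa i) (amin _ _ qCz).
  exact: subalgebraC (subalgP _) R'z.
- by case/eqP: x0; apply: eq_bot_le_compl (le_trans xw wy) xy.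
- by case/eqP: q0; apply: eq_bot_le_compl qw qCw.
Qed.

End SFN_FN.

Lemma SFN_FN d disp (A : ctbDistrLatticeType disp) : has_SFN d A -> has_FN d A.
Proof.
move=> [E [finE cofE commE]]; exists (directed_unions E).
  exact: directed_unions_club.
exact: directed_unions_rc commE.
Qed.

(** * Projective algebras have the SFN *)

Section GreatestBelow.
Variables (d : Order.disp_t) (A : ctbDistrLatticeType d).
Implicit Types (X T : set A) (x y v : A).

(** By residuation, membership of a normal form below [y] amounts to separate upper bounds on its
    coefficients, so two projections to the algebra of [T] suffice. *)
Lemma rc_adjoin T x : relatively_complete (gen_subalg T) ->
  relatively_complete (gen_subalg (T `|` [set x])).
Proof.
move=> rcT y.
have [a [Ta ay amax]] := rcT (y `|` ~` x).
have [b [Tb bY bmax]] := rcT (y `|` ~` ~` x).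
have [_ _ XC XI XU] := subalgP (gen_subalg (T `|` [set x])).
have Xx : gen (T `|` [set x]) x by apply: sub_gen; right.
have TX := genS (@subsetUl _ T [set x]).
exists ((a `&` x) `|` (b `&` ~` x)); split.
- by apply: XU; apply: XI; auto.
- by rewrite leUx !le_joinC ay bY.
move=> z /gen_adjoin[a' [b' [Ta' Tb' ->]]].
rewrite leUx !le_joinC => /andP[ay' by'].
by rewrite leU2 // leI2 //; [exact: amax|exact: bmax].
Qed.

Lemma rc_adjoin_finite T X : relatively_complete (gen_subalg T) ->
  finite_set X -> relatively_complete (gen_subalg (T `|` X)).
Proof.
move=> rcT /finite_seqP[s ->]; elim: s => [|x s IHs].
  by rewrite (_ : [set` [::]] = set0) ?setU0 //; apply/seteqP; split.
rewrite (_ : T `|` [set` x :: s] = T `|` [set` s] `|` [set x])%classic.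
  exact: rc_adjoin.
apply/seteqP; split=> y /=; rewrite inE.
  by case=> [|/orP[/eqP|]]; [left; left|right|left; right].
by case=> [[]|->]; [left|move=> ->; right; rewrite orbT|right; rewrite eqxx].
Qed.

End GreatestBelow.

(** * Free algebras and their retracts *)

Definition free_on (X : Type) d (F : ctbDistrLatticeType d) (x : X -> F) : Prop :=
  (forall u, gen (range x) u) /\
  forall d' (C : ctbDistrLatticeType d') (c : X -> C),
    exists h : {bahom F -> C}, forall i, h (x i) = c i.

(** The four-element algebra [set bool] is free on [[set true]]; a coproduct of its copies then
    gives any free algebra. *)
Lemma hom_from_set_bool d (C : ctbDistrLatticeType d) (c : C) :
  exists h : {bahom set bool -> C}, h [set true] = c.
Proof.
pose h (U : set bool) : C :=
  (if true \in U then c else \bot) `|` (if false \in U then ~` c else \bot).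
have hI : {morph h : U V / U `&` V}.
  move=> U V; rewrite /h -[(U `&` V)%O]/(U `&` V)%classic !in_setI.
  case: (true \in U); case: (false \in U); case: (true \in V); case: (false \in V);
    by rewrite /= ?(joinxC, joinx0, join0x)
               ?(meetxx, meetxC, meetCx, meetx0, meet0x, meetx1, meet1x).
have hU : {morph h : U V / U `|` V}.
  move=> U V; rewrite /h -[(U `|` V)%O]/(U `|` V)%classic !in_setU joinACA.
  by case: (true \in U); case: (false \in U); case: (true \in V); case: (false \in V);
    rewrite /= ?joinxx ?joinx0 ?join0x ?joinxx.
have h0 : h \bot = \bot by rewrite /h !in_set0 joinxx.
have h1 : h \top = \top by rewrite /h !in_setT joinxC.
pose H := isBAHom.Build _ _ _ _ h hI hU h0 h1.
pose g : {bahom set bool -> C} := HB.pack h H.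
exists g; rewrite /g /= /h mem_set // memNset ?joinx0 //=.
Qed.

Lemma free_exists (X : Type) :
  exists (F : ctbDistrLatticeType set_display) (x : X -> F), free_on x.
Proof.
pose K (_ : X) : ctbDistrLatticeType set_display := set bool.
pose x (i : X) : coprod K := cofactor_hom K i [set true].
exists (coprod K), x; split=> [|d' C c].
  have [G0 G1 GC GI GU] := subalgP (gen_subalg (range x)).
  have Gx i : gen (range x) (x i) by apply: sub_gen; exists i.
  apply: coprod_subalgebra => [|i U]; first exact: subalgP.
  rewrite -[cofactor i U]/(cofactor_hom K i U).
  have [Ut|nUt] := pselect (U true); have [Uf|nUf] := pselect (U false).
  - by rewrite (_ : U = \top) ?omorph1 //; apply/seteqP; split=> -[].
  - by rewrite (_ : U = [set true]); [exact: Gx | apply/seteqP; split=> -[]].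
  - rewrite (_ : U = ~` ([set true] : K i)); last first.
      by apply/seteqP; split=> -[] Ub; [case: nUt|move=> //|case: Ub|exact: Uf].
    by rewrite bahomC; apply: GC; exact: Gx.
  - by rewrite (_ : U = \bot) ?omorph0 //; apply/seteqP; split=> -[].
pose f i : {bahom K i -> C} := projT1 (cid (hom_from_set_bool (c i))).
have [h hE] := coprod_lift f; exists h => i; rewrite [LHS]hE.
exact: projT2 (cid (hom_from_set_bool (c i))).
Qed.

(** An equalizer relativized to the part below [y]; [y = \top] gives the ordinary one. *)
Lemma equalizer_subalgebra d (A : ctbDistrLatticeType d) d' (B : ctbDistrLatticeType d')
    (g h : {bahom A -> B}) (y : B) :
  is_subalgebra [set u | y `&` g u = y `&` h u].
Proof.
apply: subalgebra_weak => /=.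
- by rewrite !omorph0.
- move=> u uy; rewrite !bahomC -[LHS]joinx0 -[RHS]joinx0 -(meetxC y) -!meetUr.
  by rewrite !(joinC _ (~` y)) -!complI uy.
- by move=> u v uy vy; rewrite !omorphI /= -[y]meetxx meetACA uy vy meetACA.
Qed.

(** Of the finitely many generators that [u] involves, those outside [T] are eliminated one by one,
    as by universal quantification: the elements of the algebra of [T] below [u] are those below
    both results of substituting [\top] and [\bot] for [x i]. *)
Lemma free_rc (X : choiceType) d (F : ctbDistrLatticeType d) (x : X -> F) (T : set X) :
  free_on x -> relatively_complete (gen_subalg (x @` T)).
Proof.
move=> [Fgen Flift] u.
have [s Gu] : exists s : seq X, gen (x @` ([set` s] `|` T)) u.
  have [E [/finite_seqP[s ->] _ Gu]] :=
    @gen_bigcup_finite _ _ _ setT (fun i => [set x i]) u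
      (genS (fun y '(ex_intro2 i _ xi) => ex_intro2 _ _ i I (esym xi)) (Fgen u)).
  exists s; apply: genS Gu => y [i si ->]; exists i => //; by left.
elim: s u Gu => [|i s IHs] u Gu.
  exists u; split=> //; apply: genS Gu => y [j [//|Tj] <-]; by exists j.
have [Ti|nTi] := pselect (T i).
  apply: IHs; apply: genS Gu => y [j + <-].
  by rewrite /= inE => -[/orP[/eqP->|sj]|Tj];
    [exists i; [right|]|exists j; [left|]|exists j; [right|]].
have [e eE] : exists e : bool -> {bahom F -> F}, forall b j,
    e b (x j) = if j == i then (if b then \top else \bot) else x j.
  pose c b j := if j == i then (if b then \top else \bot) else x j.
  by exists (fun b => projT1 (cid (Flift _ _ (c b)))) => b; case: (cid _).
have eGu b : gen (x @` ([set` s] `|` T)) (e b u).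
  move: u Gu; apply: gen_sub; first exact: preimage_subalgebra (subalgP _).
  have [G0 G1 _ _ _] := subalgP (gen_subalg (x @` ([set` s] `|` T))).
  move=> _ [j sTj <-]; rewrite /= eE; case: eqP => [_|ji]; first by case: b.
  apply: sub_gen; exists j => //; case: sTj => [|Tj]; last by right.
  by rewrite /= inE => /orP[/eqP//|]; left.
(* Below [x i], or below its complement, substituting the corresponding constant changes nothing. *)
have split_u b : (if b then x i else ~` x i) `&` u = (if b then x i else ~` x i) `&` e b u.
  move: u (Fgen u) {Gu eGu}.
  apply: gen_sub (equalizer_subalgebra (idfun : {bahom F -> F}) (e b) _) _.
  move=> _ [j _ <-]; rewrite /= eE; case: eqP => // ->.
  by case: b; rewrite ?meetxx ?meetx1 // meetCx meetx0.
have [|v [Tv vu vmax]] := IHs (e true u `&` e false u).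
  by apply: subalgebraI (subalgP _) _ _.
exists v; split=> //.
  apply: le_trans vu _; rewrite -[leLHS]meet1x -(joinxC (x i)) meetUl leUx.
  apply/andP; split.
    apply: le_trans (leI2 (lexx _) (leIl _ _)) _.
    by rewrite -(split_u true) leIr.
  apply: le_trans (leI2 (lexx _) (leIr _ _)) _.
  by rewrite -(split_u false) leIr.
move=> w Tw wu; apply: vmax => //.
have ew b : e b w = w.
  have : \top `&` e b w = \top `&` w; last by rewrite !meet1x.
  move: w Tw {wu}.
  apply: gen_sub (equalizer_subalgebra (e b) (idfun : {bahom F -> F}) \top) _.
  move=> _ [j Tj <-]; rewrite /= eE; case: eqP => // ji.
  by case: nTi; rewrite -ji.
by rewrite lexI -{1}(ew true) -{2}(ew false) !omorph_le.
Qed.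

(** The map from the free algebra on the set [A] that extends the identity is onto, hence an
    epimorphism, and projectivity lifts the identity through it. *)
Lemma projective_retract d (A : ctbDistrLatticeType d) : projective A ->
  exists (F : ctbDistrLatticeType set_display) (x : A -> F)
    (p : {bahom F -> A}) (g : {bahom A -> F}),
    [/\ free_on x, forall a, p (x a) = a & forall a, p (g a) = a].
Proof.
move=> projA; have [F [x [Fgen Flift]]] := free_exists A.
have [p px] := Flift _ A id.
have [|g pg] := projA _ F _ A p (idfun : {bahom A -> A}).
  by move=> d'' C h k hk a; rewrite -(px a); apply: hk.
by exists F, x, p, g; split.
Qed.

(* The empty tuple does not commute in the trivial algebra, since its amalgam
   is the two-element algebra. *)
Lemma projective_nontrivial d (A : ctbDistrLatticeType d) :
  projective A -> \top != \bot :> A.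
Proof.
move=> /projective_retract[F [x [p [g [[_ Flift] px pg]]]]].
apply/eqP => A10; have [h _] := Flift _ bool (fun _ => true).
have : h (g \top) = h (g \bot) by rewrite A10.
by rewrite (omorph1 g) (omorph1 h) (omorph0 g) (omorph0 h).
Qed.

(** [supp a] consists of finitely many generators that yield [g a]. If [T] is closed under it, [g]
    maps the algebra of [T] into that of the generators indexed by [T]; project [g y] there and
    apply [p]. *)
Lemma projective_support d (A : ctbDistrLatticeType d) : projective A ->
  exists2 supp : A -> set A, forall a, finite_set (supp a) &
    forall T, (forall a, T a -> supp a `<=` T) ->
      relatively_complete (gen_subalg T).
Proof.
move=> /projective_retract[F [x [p [g [Ffree px pg]]]]].
have /choice[supp suppP] a :
    exists s : set A, finite_set s /\ gen (x @` s) (g a).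
  have [s [fins _ sg]] := @gen_bigcup_finite _ _ _ setT (fun i => [set x i]) (g a)
      (genS (fun y '(ex_intro2 i _ xi) => ex_intro2 _ _ i I (esym xi)) (Ffree.1 (g a))).
  by exists s; split=> //; apply: genS sg => y [i si ->]; exists i.
exists supp => [a|T suppT]; first by case: (suppP a).
move=> y; have [v [Tv vy vmax]] := free_rc T Ffree (g y).
exists (p v); split.
- move: v Tv {vy vmax}; apply: gen_sub; first exact: preimage_subalgebra (subalgP _).
  by move=> _ [a Ta <-]; rewrite /= px; apply: sub_gen.
- by rewrite -[y]pg omorph_le.
move=> w Tw wy; rewrite -[w]pg omorph_le //; apply: vmax; last exact: omorph_le.
move: w Tw {wy}; apply: gen_sub; first exact: preimage_subalgebra (subalgP _).
move=> a Ta /=; apply: genS (suppP a).2 => _ [c ac <-].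
by exists c => //; apply: suppT ac.
Qed.

(** * Well-orderings and the filtration of a projective algebra *)

Definition well_ordering (T : eqType) (R : rel T) : Prop :=
  [/\ total R, transitive R, antisymmetric R &
    forall P : set T, P !=set0 -> exists2 x, P x & forall y, P y -> R x y].

(** Totality and transitivity come from least elements of sets of two or three elements,
    antisymmetry from uniqueness of the least one. *)
Lemma well_ordering_exists (T : eqType) : exists R : rel T, well_ordering R.
Proof.
have [R Rwo] := well_ordering_principle T; exists R.
have Rmin (P : {pred T}) x : x \in P ->
    exists2 z, z \in P & forall y, y \in P -> R z y.
  by move=> Px; have [|z [[Pz zmin] _]] := Rwo P; [exists x|exists z].
have Rtot : total R.
  move=> x y; have [|z] := Rmin (pred2 x y) x; first by rewrite inE eqxx.
  by rewrite inE => /orP[]/eqP-> zmin; rewrite zmin ?orbT // inE eqxx ?orbT.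
have Ranti : antisymmetric R.
  move=> x y /andP[xy yx]; have [|z [_ zuniq]] := Rwo (pred2 x y).
    by exists x; rewrite inE eqxx.
  have Rxx u : R u u by have := Rtot u u; rewrite orbb.
  have zx : z = x.
    by apply: zuniq; split=> [|u]; rewrite inE ?eqxx // => /orP[]/eqP->.
  rewrite -zx; apply: zuniq; split=> [|u]; first by rewrite inE eqxx orbT.
  by rewrite inE => /orP[]/eqP->.
split=> // [y x z xy yz|P [x Px]].
  have [|m] := Rmin (pred3 x y z) x; first by rewrite inE eqxx.
  rewrite inE => /or3P[]/eqP-> mmin.
  - by apply: mmin; rewrite inE eqxx !orbT.
  - by rewrite (Ranti x y) // xy mmin // inE eqxx.
  - by rewrite -(Ranti y z) // yz mmin // inE eqxx orbT.
have [|z /asboolP Pz zmin] := Rmin (fun y => `[< P y >]) x; first exact/asboolP.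
by exists z => // y Py; apply/zmin/asboolP.
Qed.

Lemma well_ordering_lexi (T U : eqType) (R : rel U) (b : T -> U) (r : T -> nat) :
  well_ordering R ->
  (forall x y, b x = b y -> r x = r y -> x = y) ->
  well_ordering (fun x y => if b x == b y then (r x <= r y)%N else R (b x) (b y)).
Proof.
move=> [Rtot Rtr Ranti Rmin] br; split.
- by move=> x y; rewrite [b y == _]eq_sym; case: eqP => _; [exact: leq_total|exact: Rtot].
- move=> y x z; case: (eqVneq (b x) (b y)) => [->|xy].
    by case: eqP => // _; exact: leq_trans.
  case: (eqVneq (b y) (b z)) => [<-|yz]; first by rewrite (negbTE xy).
  case: (eqVneq (b x) (b z)) => [xz|_]; last exact: Rtr.
  rewrite -xz in yz *; move=> Rxy Ryx; case/eqP: xy; apply: Ranti.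
  by rewrite Rxy.
- move=> x y; rewrite [b y == _]eq_sym; case: eqP => [bxy|nb] /andP[xy yx].
    by apply: br => //; apply/eqP; rewrite eqn_leq xy.
  by case: nb; apply: Ranti; rewrite xy.
move=> P [x Px].
have [|_ [y Py <-] ymin] := Rmin (b @` P); first by exists (b x); exists x.
have ex : exists n, `[< exists2 z, P z & b z = b y /\ r z = n >].
  by exists (r y); apply/asboolP; exists y.
case: (ex_minnP ex) => n /asboolP[z Pz [bz rz]] nmin.
exists z => // w Pw; rewrite bz; case: eqP => [bw|_]; last by apply: ymin; exists w.
by rewrite rz; apply: nmin; apply/asboolP; exists w.
Qed.

Lemma countable_closure (T : choiceType) (supp : T -> set T) (x : T) :
  (forall y, finite_set (supp y)) ->
  exists S : set T, [/\ S x, countable S & forall y, S y -> supp y `<=` S].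
Proof.
move=> finsupp.
pose S := fix S n := if n is m.+1 then \bigcup_(y in S m) supp y else [set x].
exists (\bigcup_n S n); split; first by exists 0%N.
  apply: bigcup_countable => [|n _]; first exact: countableP.
  apply: finite_set_countable; elim: n => [|n IHn] /=; first exact: finite_set1.
  exact: bigcup_finite.
by move=> y [n _ Sy] z yz; exists n.+1 => //; exists y.
Qed.

Definition initial_segment (T : eqType) (R : rel T) (a : T) : set T :=
  [set c | R c a /\ c != a].

(** The block of [a] is given by the first [i] whose countable closed set [S i] contains [a], and
    each block is ordered by a rank in [nat]. A segment is then the union [T] of the earlier blocks,
    closed under [supp], and a finite part [G] of the current block. *)
Lemma projective_filtration d (A : ctbDistrLatticeType d) : projective A ->
  exists2 R : rel A, well_ordering R &
    forall a, relatively_complete (gen_subalg (initial_segment R a)).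
Proof.
move=> /projective_support[supp finsupp rc_supp].
have [R Rwo] := well_ordering_exists A; have [Rtot Rtr Ranti Rmin] := Rwo.
have /choice[S SP] a := countable_closure a finsupp.
have /choice[b bP] a : exists i, S i a /\ forall j, S j a -> R i j.
  by have [|i Si imin] := Rmin [set i | S i a]; [exists a; case: (SP a)|exists i].
have /choice[f fP] i : exists f : A -> nat, {in S i &, injective f} /\
    forall n, finite_set [set x | S i x /\ (f x < n)%N].
  by have [_ /countable_rank[f f_inj finf] _] := SP i; exists f.
pose r a := f (b a) a.
exists (fun x y => if b x == b y then (r x <= r y)%N else R (b x) (b y)).
  apply: well_ordering_lexi Rwo _ => x y bxy; rewrite /r bxy.
  by apply: (fP (b y)).1; rewrite inE; [rewrite -bxy; case: (bP x)|case: (bP y)].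
move=> a.
pose T := [set c | R (b c) (b a) /\ b c != b a].
pose G := [set c | b c = b a /\ (r c < r a)%N].
rewrite /initial_segment (_ : [set c | _] = (T `|` G)%classic); last first.
  apply/seteqP; split=> c.
    move=> [+ ca]; case: eqP => [bc|/eqP bc ?]; last by left.
    rewrite leq_eqVlt => /orP[/eqP rc|?]; last by right.
    case/eqP: ca; move: rc; rewrite /r bc => rc; apply: (fP (b a)).1 rc; rewrite inE.
      by rewrite -bc; case: (bP c).
    by case: (bP a).
  move=> [[Rc bc]|[bc rc]] /=.
    by rewrite (negbTE bc); split=> //; apply: contraNneq bc => ->.
  by rewrite bc eqxx ltnW //; split=> //; apply: contraTneq rc => ->; rewrite ltnn.
apply: rc_adjoin_finite; last first.
  apply: sub_finite_set ((fP (b a)).2 (r a)) => c [bc rc].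
  by move: rc; rewrite /r bc => rc; split=> //; rewrite -bc; case: (bP c).
apply: rc_supp => c [Rc bc] e ce.
(* [supp c] stays inside [S (b c)], so none of its elements is in a later block. *)
have Rec : R (b e) (b c).
  by apply: (bP e).2; have [_ _] := SP (b c); apply; [|exact: ce]; case: (bP c).
split; first exact: Rtr Rec Rc.
by apply: contraNneq bc => be; apply/eqP/Ranti; rewrite Rc -be.
Qed.

(** * Finite generating sets whose algebras commute *)

Section GoodSets.
Variables (d : Order.disp_t) (A : ctbDistrLatticeType d) (R : rel A).
Hypothesis Rwo : well_ordering R.
Hypothesis rcR : forall a, relatively_complete (gen_subalg (initial_segment R a)).
Hypothesis A10 : \top != \bot :> A.

Let below a := initial_segment R a.

(** Both [a] and its complement are treated because an ultrafilter may contain either. *)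
Definition good (f : set A) : Prop := forall a e, f a -> e = a \/ e = ~` a ->
  exists v, [/\ gen (f `&` below a) v, v <= e &
    forall w, gen (below a) w -> w <= e -> w <= v].

Lemma good_bigcup I (D : set I) (f : I -> set A) :
  (forall i, D i -> good (f i)) -> good (\bigcup_(i in D) f i).
Proof.
move=> goodf a e [i Di fa] /(goodf i Di a e fa)[v [fv ve vmax]].
exists v; split=> //; apply: genS fv => c [fc ca]; split=> //; by exists i.
Qed.

(** Consider the least [b] in no finite good set. The projections of [b] and of its complement use
    finitely many earlier elements; the union of finite good sets around these stays good when [b]
    is added. *)
Lemma good_cofinal (F : set A) : finite_set F ->
  exists f, [/\ finite_set f, good f & F `<=` f].
Proof.
suff good1 a : exists f, [/\ finite_set f, good f & f a].
  have /choice[f fP] := good1; move=> finF.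
  exists (\bigcup_(a in F) f a); split.
  - by apply: bigcup_finite => // a _; case: (fP a).
  - by apply: good_bigcup => a _; case: (fP a).
  - by move=> a Fa; exists a => //; case: (fP a).
have [_ _ Ranti Rmin] := Rwo.
apply: contrapT => bad_a.
have [|b bad_b bmin] := Rmin [set a | ~ exists f, [/\ finite_set f, good f & f a]].
  by exists a.
apply: bad_b.
have /choice[f fP] c : exists f, below b c -> [/\ finite_set f, good f & f c].
  have [[cb nbc]|?] := pselect (below b c); last by exists set0.
  suff [f fP] : exists f, [/\ finite_set f, good f & f c] by exists f.
  apply: contrapT => /bmin bc; case/eqP: nbc; apply: Ranti; rewrite cb; exact: bc.
have cover e : exists v, exists G, [/\ finite_set G, G `<=` below b, gen G v,
    v <= e & forall w, gen (below b) w -> w <= e -> w <= v].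
  have [v [bv ve vmax]] := rcR b e.
  by have [G [finG Gb Gv]] := gen_finite bv; exists v, G.
have [v1 [G1 [finG1 G1b G1v v1e v1max]]] := cover b.
have [v2 [G2 [finG2 G2b G2v v2e v2max]]] := cover (~` b).
pose g := (\bigcup_(c in G1 `|` G2) f c)%classic.
have Gb : (G1 `|` G2)%classic `<=` below b by move=> c [/G1b|/G2b].
have Gg : (G1 `|` G2)%classic `<=` g.
  by move=> c Gc; exists c => //; case: (fP c (Gb c Gc)).
exists (g `|` [set b])%classic; split.
- rewrite finite_setU; split; last exact: finite_set1.
  apply: bigcup_finite; first by rewrite finite_setU.
  by move=> c /Gb/fP[].
- have goodg : good g by apply: good_bigcup => c /Gb/fP[].
  move=> c e [gc|->] ce.
    have [v [gv ve vmax]] := goodg c e gc ce.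
    by exists v; split=> //; apply: genS gv => x [gx xc]; split=> //; left.
  case: ce => ->; [exists v1|exists v2]; split=> //.
    by apply: genS G1v => x Gx; split; [left; apply: Gg; left|exact: G1b].
  by apply: genS G2v => x Gx; split; [left; apply: Gg; right|exact: G2b].
- by right.
Qed.

Lemma good_commute n (f : 'I_n -> set A) :
  (forall i, finite_set (f i)) -> (forall i, good (f i)) ->
  Defs.commute (fun i => gen_subalg (f i)).
Proof.
move=> finf goodf; apply: commute_of_meet_neq0 => [i|q qP q_compat].
  exact: finite_gen.
have [Rtot Rtr Ranti _] := Rwo.
have [s0 s0E] : exists s0 : seq A, \bigcup_i f i = [set` s0].
  by apply/finite_seqP/bigcup_finite => // ; exact: finite_finset.
pose s := sort R (undup s0).
have s_sorted : sorted R s by apply: sort_sorted.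
have s_uniq : uniq s by rewrite sort_uniq undup_uniq.
have sE c : (c \in s) = (c \in s0) by rewrite mem_sort mem_undup.
have fs i c : f i c -> c \in s.
  by move=> fc; have : (\bigcup_i f i) c; [exists i | rewrite s0E /= -sE].
pose agree i x c := q i <= c /\ x <= c \/ q i <= ~` c /\ x <= ~` c.
(* Since [x] is in the algebra of the prefix, it is in that of the segment below the next generator,
   where projections bound it. *)
have prefix l r : s = l ++ r -> exists x, [/\ x != \bot, gen [set` l] x &
    forall i c, c \in l -> f i c -> agree i x c].
  elim/last_ind: l r => [|l a IHl] r sl.
    (* The empty prefix starts from [\top], nonzero by [A10]. *)
    exists \top; split=> //.
    by case: (subalgP (gen_subalg [set` ([::] : seq A)])).
  have [|x [x0 lx xP]] := IHl (a :: r); first by rewrite -cat_rcons.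
  have [m _ fma] : (\bigcup_i f i) a.
    by rewrite s0E /= -sE sl mem_cat mem_rcons inE eqxx.
  have s_pair : pairwise R (rcons l a ++ r) by rewrite -sl -sorted_pairwise.
  have l_below c : c \in l -> below a c.
    move=> cl; split.
      by move: s_pair; rewrite pairwise_cat pairwise_rcons => /and3P[_ /andP[/allP + _] _]; apply.
    apply: contraTneq s_uniq => ca; rewrite sl cat_uniq rcons_uniq.
    by rewrite -ca cl.
  have below_l c : c \in s -> below a c -> c \in l.
    move=> cs [ca nca]; move: cs; rewrite sl mem_cat mem_rcons inE (negbTE nca) /=.
    case/orP => // cr; case/eqP: nca; apply: Ranti.
    rewrite ca; move: s_pair; rewrite pairwise_cat => /andP[/allrelP + _].
    by apply=> //; rewrite mem_rcons inE eqxx.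
  have fS i c : f i c -> gen (f i) c by apply: sub_gen.
  (* [e] is the choice of [q m] between [a] and its complement; compatibility makes it the choice of
     every [q i] with [a] in [f i]. *)
  have [e [ea qe]] : exists e, (e = a \/ e = ~` a) /\ q m <= e.
    have [_ [_ qm]] := qP m; case: (qm a (fS _ _ fma)) => qa.
      by exists a; split; [left|].
    by exists (~` a); split; [right|].
  have qie i : f i a -> q i <= e.
    move=> fia; apply: (q_compat m i) qe.
      by case: ea => ->; [|apply: subalgebraC (subalgP _) _]; exact: fS.
    by case: ea => ->; [|apply: subalgebraC (subalgP _) _]; exact: fS.
  have eCa : ~` e = a \/ ~` e = ~` a by case: ea => ->; rewrite ?complK; [right|left].
  have xe0 : x `&` e != \bot.
    apply/negP; rewrite -le_compl_meet => xe.
    (* Goodness is applied to the complement of [e]: [x] is below its projection [v], on which [x]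
       and [q m] agree, so [q m] would be disjoint from [e]. *)
    have [v [fv ve vmax]] := goodf m a (~` e) fma eCa.
    have xv : x <= v.
      by apply: vmax => //; apply: genS lx.
    have agree_fm c : (f m `&` below a) c -> agree m x c.
      move=> [fmc ca]; apply: xP => //; apply: below_l => //.
      exact: fs fmc.
    case: (agree_gen agree_fm fv) => -[qv xv'].
      have [_ [q0 _]] := qP m; case/eqP: q0.
      exact: eq_bot_le_compl qe (le_trans qv ve).
    by case/eqP: x0; apply: eq_bot_le_compl xv xv'.
  exists (x `&` e); split=> //.
    apply: subalgebraI (subalgP _) _ _.
      by apply: genS lx => c; rewrite /= mem_rcons inE => ->; rewrite orbT.
    have ga : gen [set` rcons l a] a by apply: sub_gen; rewrite /= mem_rcons inE eqxx.
    by case: ea => ->; [|apply: subalgebraC (subalgP _) _].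
  move=> i c; rewrite mem_rcons inE => /orP[/eqP ->|cl] fic.
    by case: ea (qie i fic) => -> qi; [left|right]; split=> //; rewrite leIr.
  by case: (xP i c cl fic) => -[qc xc]; [left|right]; split=> //; apply: le_trans (leIl _ _) xc.
have [|x [x0 _ xP]] := prefix s [::]; first by rewrite cats0.
exists x => // i; have [Bq [q0 _]] := qP i.
have agree_f c : f i c -> agree i x c.
  move=> fc; apply: xP => //.
  exact: fs fc.
case: (agree_gen agree_f Bq) => -[// qCq _].
by case/eqP: q0; apply: eq_bot_le_compl (lexx _) qCq.
Qed.

End GoodSets.

Lemma projective_SFN d disp (A : ctbDistrLatticeType disp) :
  projective A -> has_SFN d A.
Proof.
move=> projA; have [R Rwo rcR] := projective_filtration projA.
exists [set S | exists f, [/\ finite_set f, good R f & S = gen_subalg f]]; split.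
- by move=> _ [f [finf _ ->]]; apply: finite_gen.
- move=> F /(good_cofinal Rwo rcR)[f [finf goodf Ff]].
  exists (gen_subalg f); first by exists f.
  by apply: subset_trans Ff _; apply: sub_gen.
move=> n B _ /choice[f fP].
have -> : B = fun i => gen_subalg (f i) by apply: funext => i; case: (fP i).
by apply: (good_commute Rwo (projective_nontrivial projA)) => i; case: (fP i).
Qed.

Theorem theorem2p25 (d : ord_le_omega) (hd : nat_le_ord 1 d) :
  (forall (disp : Order.disp_t) (A : ctbDistrLatticeType disp),
      projective A -> has_SFN d A) /\
  (forall (disp : Order.disp_t) (A : ctbDistrLatticeType disp),
      has_SFN d A -> has_FN d A).
Proof. by split=> disp A; [exact: projective_SFN | exact: SFN_FN]. Qed.
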